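(* For every $k\ge1$ there are constants $c,c'>0$ such that the following holds. Let $n\ge 2k$, and suppose that $w_1,\ldots,w_{k+1}:[n]^{(k)}\to\mathbb{R}$ are weighted $k$-uniform hypergraphs on $[n]$ such that $w_i([n])=0$ and $\|w_i\|_1=\binom nk$ for every $i$. Then there are distinct $i$ and $j$ such that $$\operatorname{disc}^+(w_i,w_j)\operatorname{disc}^-(w_i,w_j)\ge cn^{k+1}.$$ In particular, there are $i<j$ such that $\operatorname{disc}(w_i,w_j)\ge c'n^{(k+1)/2}$.
   Context: $[n]=\{1,\ldots,n\}$ and $V^{(k)}$ denotes the family of $k$-element subsets of $V$. A weighted $k$-uniform hypergraph on $V$ is a function $w:V^{(k)}\to\mathbb{R}$; $w(S)=\sum_{e\in S^{(k)}}w(e)$, $\|w\|_1=\sum_{e}|w(e)|$, $\langle w,u\rangle=\sum_{e\in V^{(k)}}w(e)u(e)$, and $d(w)=w(V)/\binom{|V|}{k}$. For a permutation $\pi$ of $V$, $w_\pi(e)=w(\pi^{-1}(e))$. With $n=|V|$, $\operatorname{disc}^+(w,u)=\max_\pi\langle w_\pi,u\rangle-d(w)d(u)\binom nk$, $\operatorname{disc}^-(w,u)=d(w)d(u)\binom nk-\min_\pi\langle w_\pi,u\rangle$ (over all permutations $\pi$ of $V$), and $\operatorname{disc}(w,u)=\max\{\operatorname{disc}^+(w,u),\operatorname{disc}^-(w,u)\}$. *)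

(* Defs.v *)
From mathcomp Require Import all_boot all_order all_algebra.
From mathcomp Require Import fingroup perm.
From mathcomp Require Import reals.
Set Implicit Arguments. Unset Strict Implicit. Unset Printing Implicit Defensive.
Import Order.TTheory GRing.Theory Num.Theory.
Local Open Scope ring_scope.

(* A weighted k-uniform hypergraph on [n] = 'I_n is a function on subsets;
   only its values on k-element subsets matter (all sums range over them). *)
Definition hgraph (R : realType) (n : nat) := {set 'I_n} -> R.

Section Disc.
Variables (R : realType) (n k : nat).
Implicit Types (w u : hgraph R n) (pi : {perm 'I_n}).

Definition wtot w : R := \sum_(e : {set 'I_n} | #|e| == k) w e.
Definition norm1 w : R := \sum_(e : {set 'I_n} | #|e| == k) `|w e|.
Definition inner w u : R := \sum_(e : {set 'I_n} | #|e| == k) w e * u e.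
Definition dens w : R := wtot w / (binomial n k)%:R.
Definition wperm w pi : hgraph R n := fun e => w ((pi^-1)%g @: e).

(* max / min over all permutations (seeded with the identity permutation,
   which is itself one of the values) *)
Definition maxinner w u : R :=
  \big[Num.max/inner (wperm w 1%g) u]_(pi : {perm 'I_n}) inner (wperm w pi) u.
Definition mininner w u : R :=
  \big[Num.min/inner (wperm w 1%g) u]_(pi : {perm 'I_n}) inner (wperm w pi) u.

Definition discp w u : R := maxinner w u - dens w * dens u * (binomial n k)%:R.
Definition discm w u : R := dens w * dens u * (binomial n k)%:R - mininner w u.
Definition disc w u : R := Num.max (discp w u) (discm w u).
End Disc.

(* Main.v *)
(* Split all but at most one of the vertices into pairs [x_i], [y_i].  For
   bijections [al], [be] from this model onto the vertices, [<w o al, u o be>]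
   is, as a function of which pairs are swapped in [al], a polynomial of degree
   at most [k] on the cube; its values lie between [- disc^-] and [disc^+] and
   average to [0].

   For a set [A] of pairs let [M_A(w)] be the sum of [w] over the [k]-sets
   transversal to [A], with the product sign.  An L1 Poincare inequality,
   iterated [k] times, shows that a [w] of total weight [0] and L1 norm
   [binom n k] has [E|M_A(w)|] of order [n^(k-d)] for some [1 <= d <= k] and
   all [|A| = d].  Given [k+1] hypergraphs, two of them share this [d].  By
   symmetry the Walsh coefficient of [<w o al, u o be>] at [A] has mean absolute
   value at least of order [E|M_A(w)| E|M_A(u)| / n^(k-d)], that is [n^(k-d)].

   Fix a set [I] of about [m/k] of the [m] pairs.  The slope of a pair [i] of
   [I], as a function of the swaps outside [I], is a low degree polynomial with
   about [n^(d-1)] coefficients of order [n^(k-d)], so Bonami's inequality gives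
   it L1 norm at least of order [n^((k-1)/2)].  Swapping each pair of [I] with
   bias [t] in the direction of its slope gives a polynomial in [t] of degree at
   most [k], whose derivative at [0] is the sum of the absolute slopes, of order
   [n^((k+1)/2)] on average.  As this polynomial stays in [[- disc^-, disc^+]]
   on [[-1, 1]] and has mean [0] at [0], comparing it with a parabola bounds the
   square of the average derivative by a multiple of [disc^+ disc^-]. *)
From mathcomp Require Import all_boot all_order all_algebra.
From mathcomp Require Import fingroup perm.
From mathcomp Require Import reals.
From mathcomp Require Import ring lra zify.
Require Import Defs.
Import Order.TTheory GRing.Theory Num.Theory.
Set Implicit Arguments. Unset Strict Implicit. Unset Printing Implicit Defensive.
Local Open Scope ring_scope.

(** * Averages and the cube *)

Section Average.
Variable R : realType.

Definition avg (X : finType) (f : X -> R) : R := (\sum_x f x) / #|X|%:R.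

Lemma eq_avg (X : finType) (f g : X -> R) : f =1 g -> avg f = avg g.
Proof. by move=> fg; rewrite /avg (eq_bigr g). Qed.

Lemma avgD (X : finType) (f g : X -> R) :
  avg (fun x => f x + g x) = avg f + avg g.
Proof. by rewrite /avg big_split mulrDl. Qed.

Lemma avgZ (X : finType) c (f : X -> R) : avg (fun x => c * f x) = c * avg f.
Proof. by rewrite /avg -mulr_sumr mulrA. Qed.

Lemma avgZr (X : finType) c (f : X -> R) : avg (fun x => f x * c) = avg f * c.
Proof. by rewrite /avg -mulr_suml mulrAC. Qed.

Lemma avg_sum (X I : finType) (P : pred I) (F : I -> X -> R) :
  avg (fun x => \sum_(i | P i) F i x) = \sum_(i | P i) avg (F i).
Proof. by rewrite /avg exchange_big /= mulr_suml. Qed.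

Lemma avg_exchange (X Y : finType) (F : X -> Y -> R) :
  avg (fun x => avg (F x)) = avg (fun y => avg (F^~ y)).
Proof.
by rewrite /avg -!mulr_suml exchange_big /= -!mulrA; congr (_ * _); rewrite mulrC.
Qed.

Lemma avg_reindex (X : finType) (h : X -> X) (f : X -> R) :
  injective h -> avg (f \o h) = avg f.
Proof. by move=> hI; rewrite /avg [in RHS](reindex_inj hI). Qed.

Lemma ler_avg (X : finType) (f g : X -> R) :
  (forall x, f x <= g x) -> avg f <= avg g.
Proof. by move=> fg; rewrite ler_wpM2r ?invr_ge0 // ler_sum. Qed.

Lemma avg_ge0 (X : finType) (f : X -> R) : (forall x, 0 <= f x) -> 0 <= avg f.
Proof. by move=> f0; rewrite mulr_ge0 ?invr_ge0 ?sumr_ge0. Qed.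

Lemma ler_norm_avg (X : finType) (f : X -> R) : `|avg f| <= avg (fun x => `|f x|).
Proof. by rewrite normrM normfV normr_nat ler_wpM2r ?invr_ge0 ?ler_norm_sum. Qed.

Lemma avg_const (X : finType) (x0 : X) (c : R) : avg (fun _ : X => c) = c.
Proof.
rewrite /avg sumr_const -[c *+ _]mulr_natr mulfK // pnatr_eq0 -lt0n.
by apply/card_gt0P; exists x0.
Qed.

Lemma cauchy_schwarz_sum (I : finType) (P : pred I) (f g : I -> R) :
  (\sum_(i | P i) f i * g i) ^+ 2 <=
  (\sum_(i | P i) f i ^+ 2) * (\sum_(i | P i) g i ^+ 2).
Proof.
set a := \sum_(i | P i) f i * g i; set b := \sum_(i | P i) f i ^+ 2.
set c := \sum_(i | P i) g i ^+ 2.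
have : 0 <= \sum_(i | P i) \sum_(j | P j) (f i * g j - f j * g i) ^+ 2.
  by apply: sumr_ge0 => i _; apply: sumr_ge0 => j _; rewrite sqr_ge0.
suff -> : \sum_(i | P i) \sum_(j | P j) (f i * g j - f j * g i) ^+ 2 =
  2 * (b * c - a ^+ 2) by rewrite pmulr_rge0 // subr_ge0.
transitivity (\sum_(i | P i) (f i ^+ 2 * c + b * g i ^+ 2 - 2 * (f i * g i) * a)).
  apply: eq_bigr => i _; rewrite !mulr_sumr mulr_suml -big_split -sumrB /=.
  by apply: eq_bigr => j _; ring.
rewrite sumrB big_split /= -mulr_suml -mulr_sumr -mulr_suml -mulr_sumr -/a -/b -/c.
ring.
Qed.

Lemma cauchy_schwarz_avg (X : finType) (f g : X -> R) :
  avg (fun x => f x * g x) ^+ 2 <= avg (fun x => f x ^+ 2) * avg (fun x => g x ^+ 2).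
Proof.
rewrite /avg exprMn [leRHS]mulrACA -[_^-1 * _^-1]expr2.
by rewrite ler_wpM2r ?sqr_ge0 ?cauchy_schwarz_sum.
Qed.

End Average.

Section Cube.
Variables (R : realType) (V : finType).
Implicit Types (A B C : {set V}).

(** Sets encode points of the cube: [sg i B] is the [i]-th coordinate of the point [B], [symd] is
    the coordinatewise product, and [chi A] is the Walsh character of [A]. *)
Definition symd A B : {set V} := [set i | (i \in A) (+) (i \in B)].
Definition sg (i : V) B : R := (-1) ^+ (i \in B).
Definition chi A B : R := \prod_(i in A) sg i B.

Lemma symdK A : involutive (symd A).
Proof. by move=> B; apply/setP => i; rewrite !inE addbA addbb. Qed.

Lemma sg_symd i A B : sg i (symd A B) = sg i A * sg i B.
Proof. by rewrite /sg inE signr_addb. Qed.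

Lemma chi_symd A B C : chi A (symd B C) = chi A B * chi A C.
Proof. by rewrite /chi -big_split /=; apply: eq_bigr => i _; rewrite sg_symd. Qed.

Lemma sg_sqr i A : sg i A * sg i A = 1.
Proof. by rewrite /sg -signr_addb addbb. Qed.

Lemma norm_sg i A : `|sg i A| = 1.
Proof. exact: normr_sign. Qed.

Lemma chi_sqr A B : chi A B * chi A B = 1.
Proof. by rewrite /chi -big_split big1 //= => i _; rewrite sg_sqr. Qed.

Lemma norm_chi A B : `|chi A B| = 1.
Proof. by rewrite normr_prod big1 // => i _; rewrite norm_sg. Qed.

Lemma chi_set1 A i : chi A [set i] = if i \in A then -1 else 1.
Proof.
case: ifPn => iA; last first.
  apply: big1 => j jA; rewrite /sg in_set1 (_ : (j == i) = false) //.
  by apply: contraNF iA => /eqP <-.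
rewrite /chi (bigD1 i) //= /sg set11 expr1 big1 ?mulr1 // => j /andP[_ ji].
by rewrite in_set1 (negPf ji).
Qed.

(** Flipping coordinate [i] changes the sign of the character and preserves [h]. *)
Lemma avg_chi0 A i (h : {set V} -> R) : i \in A ->
  (forall B, h (symd [set i] B) = h B) -> avg (fun B => chi A B * h B) = 0.
Proof.
move=> iA hh.
have E : avg (fun B => chi A B * h B) = - avg (fun B => chi A B * h B).
  rewrite -[LHS](avg_reindex _ (can_inj (symdK [set i]))) -mulN1r -avgZ.
  by apply: eq_avg => B /=; rewrite hh chi_symd chi_set1 iA mulrA.
lra.
Qed.

(* The multilinear extension of [h] is a weighted average of its values. *)
Lemma multilinear_bounds (h : {set V} -> R) (a b : R) (eps : V -> R) :
  (forall B, a <= h B <= b) -> (forall i, -1 <= eps i <= 1) ->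
  a <= \sum_A avg (fun B => chi A B * h B) * \prod_(i in A) eps i <= b.
Proof.
move=> hab eps1.
(* The density, against the uniform measure, of the product measure whose coordinate [i] has mean
   [eps i]. *)
set wt := fun B => \prod_i (1 + eps i * sg i B).
have wt0 B : 0 <= wt B.
  apply: prodr_ge0 => i _; have /andP[e1 e2] := eps1 i.
  rewrite /sg; case: (i \in B); rewrite ?expr1 ?expr0; lra.
have wt1 : avg wt = 1.
  rewrite /avg /wt.
  have -> : \sum_(B : {set V}) \prod_i (1 + eps i * sg i B) =
     \prod_(i : V) ((1 - eps i) + (1 + eps i)).
    rewrite bigA_distr; apply: eq_bigr => B _; apply: eq_bigr => i _.
    by rewrite /sg; case: (i \in B); rewrite ?expr1 ?expr0 ?mulrN1 ?mulr1.
  rewrite (eq_bigr (fun=> 2%:R)); last by move=> i _; ring.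
  have -> : #|{set V}| = (2 ^ #|V|)%N.
    by rewrite -[#|{set V}|]cardsT -powersetT card_powerset cardsT.
  by rewrite prodr_const natrX divff -?natrX // pnatr_eq0 expn_eq0.
have -> : \sum_A avg (fun B => chi A B * h B) * \prod_(i in A) eps i =
   avg (fun B => wt B * h B).
  under eq_bigr do rewrite -avgZr.
  rewrite -avg_sum; apply: eq_avg => B /=.
  rewrite /wt; under [in RHS]eq_bigr do rewrite addrC.
  rewrite bigA_distr mulr_suml; apply: eq_bigr => A _.
  rewrite mulrAC; congr (_ * _); rewrite /chi -big_split /= [RHS]big_mkcond /=.
  rewrite [LHS]big_mkcond /=; apply: eq_bigr => i _.
  by case: ifP => // _; rewrite mulrC.
have -> : a = avg (fun B => wt B * a) by rewrite avgZr wt1 mul1r.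
have -> : b = avg (fun B => wt B * b) by rewrite avgZr wt1 mul1r.
by apply/andP; split; apply: ler_avg => B; apply: ler_wpM2l => //;
  case/andP: (hab B).
Qed.

End Cube.

(** * Bonami's inequality *)

Section Bonami.
Variables (R : realType) (V : finType).
Implicit Types (A B C : {set V}) (c : {set V} -> R).

Definition walsh c B : R := \sum_A c A * chi R A B.

(** The coefficients of [s] and [r] in the splitting [s + x_v r], where neither [s] nor [r] involves
    the coordinate [v]. *)
Definition sect0 v c A : R := if v \in A then 0 else c A.
Definition sect1 v c A : R := if v \in A then 0 else c (v |: A).

Lemma sum_sect v c : \sum_A c A = \sum_A sect0 v c A + \sum_A sect1 v c A.
Proof.
rewrite (bigID (fun A : {set V} => v \in A)) /= addrC; congr (_ + _).
  by rewrite [RHS](bigID (fun A : {set V} => v \in A)) /=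
    [X in _ = X + _]big1 ?add0r => [|A vA]; rewrite ?/sect0 ?vA //;
    apply: eq_bigr => A vA; rewrite /sect0 (negPf vA).
rewrite (reindex_onto (fun A => v |: A) (fun A => A :\ v)) /=; last first.
  by move=> A vA; rewrite setD1K.
rewrite big_mkcond /=; apply: eq_bigr => A _; rewrite /sect1 setU11 /=.
have [vA|vA] := boolP (v \in A); last by rewrite setU1K // eqxx.
case: eqP => // E; by move: vA; rewrite -E !inE eqxx.
Qed.

Lemma walsh_sect v c B :
  walsh c B = walsh (sect0 v c) B + sg R v B * walsh (sect1 v c) B.
Proof.
rewrite /walsh (sum_sect v) mulr_sumr; congr (_ + _); apply: eq_bigr => A _.
  by rewrite /sect0; case: ifP; rewrite ?mul0r.
rewrite /sect1; case: ifPn => vA; first by rewrite !(mul0r, mulr0).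
by rewrite /chi big_setU1 //= mulrCA.
Qed.

Lemma walsh_invariant v c B : (forall A, v \in A -> c A = 0) ->
  walsh c (symd [set v] B) = walsh c B.
Proof.
move=> c0; apply: eq_bigr => A _; rewrite chi_symd chi_set1.
by case: ifPn => [/c0->|_]; rewrite ?mul0r ?mul1r.
Qed.

Lemma walsh_const c B : (forall A, A != set0 -> c A = 0) -> walsh c B = c set0.
Proof.
move=> c0; rewrite /walsh (bigD1 set0) //= big1 ?addr0 => [|A A0].
  by rewrite /chi big_set0 mulr1.
by rewrite c0 ?mul0r.
Qed.

Lemma avg_sg0 v (h : {set V} -> R) :
  (forall B, h (symd [set v] B) = h B) -> avg (fun B => sg R v B * h B) = 0.
Proof.
move=> hh; rewrite -[RHS](@avg_chi0 R V [set v] v h) ?set11 //.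
by apply: eq_avg => B; rewrite /chi big_set1.
Qed.

(** Induction on the coordinates in play: in the expansion of [(s + x_v r)^4] the odd powers of
    [x_v] average to [0], and Cauchy-Schwarz handles the mixed term. *)
Lemma walsh_moments (W : {set V}) D c :
  (forall A, c A != 0 -> (A \subset W) && (#|A| <= D)%N) ->
  avg (fun B => walsh c B ^+ 2) = \sum_A c A ^+ 2 /\
  avg (fun B => walsh c B ^+ 4) <= 9 ^+ D * (\sum_A c A ^+ 2) ^+ 2.
Proof.
move: {2}#|W| (erefl #|W|) => N; elim: N W D c => [|N IH] W D c WN cD.
  have {}WN : W = set0 by apply/eqP; rewrite -cards_eq0 WN.
  have c0 A : A != set0 -> c A = 0.
    move=> A0; apply/eqP; apply: contraNT A0 => /cD /andP[].
    by rewrite WN subset0.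
  have -> : \sum_A c A ^+ 2 = c set0 ^+ 2.
    rewrite (bigD1 set0) //= big1 ?addr0 // => A A0; by rewrite c0 ?expr0n.
  split.
    under eq_avg do rewrite walsh_const //; exact: (avg_const set0).
  under eq_avg do rewrite walsh_const //; rewrite (avg_const set0) -exprM.
  by rewrite ler_peMl ?exprn_even_ge0 // exprn_ege1 // ler1n.
have [v vW] : exists v, v \in W by apply/card_gt0P; rewrite WN.
set c0 := sect0 v c; set c1 := sect1 v c.
have WN' : #|W :\ v| = N by rewrite (cardsD1 v) vW in WN; case: WN.
have c0D A : c0 A != 0 -> (A \subset W :\ v) && (#|A| <= D)%N.
  rewrite /c0 /sect0; case: ifPn => [_|vA /cD /andP[AW AD]]; rewrite ?eqxx //.
  by rewrite subsetD1 AW vA.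
have c1D A : c1 A != 0 -> (A \subset W :\ v) && (#|A| < D)%N.
  rewrite /c1 /sect1; case: ifPn => [_|vA /cD /andP[]]; rewrite ?eqxx //.
  by rewrite subUset cardsU1 vA subsetD1 vA => /andP[_ ->] ->.
have [S2 S4] := IH _ _ _ WN' c0D.
(* The lower degree of [r] saves a factor [9]; for [D = 0] there is no lower degree, but then [r]
   vanishes. *)
have [R2 R4] : avg (fun B => walsh c1 B ^+ 2) = \sum_A c1 A ^+ 2 /\
    9 * avg (fun B => walsh c1 B ^+ 4) <= 9 ^+ D * (\sum_A c1 A ^+ 2) ^+ 2.
  case: D cD c0D c1D S4 => [|D] cD c0D c1D S4; last first.
    by have [-> h] := IH _ _ _ WN' c1D; rewrite exprS -mulrA ler_wpM2l.
  have c10 A : c1 A = 0 by apply/eqP; apply: contraT => /c1D; rewrite ltn0 andbF.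
  rewrite big1 => [|A _]; last by rewrite c10 expr0n.
  have W0 B : walsh c1 B = 0 by rewrite walsh_const.
  split; first by under eq_avg do rewrite W0 expr0n; rewrite (avg_const set0).
  by under eq_avg do rewrite W0 expr0n; rewrite (avg_const set0) !mulr0 expr0n mulr0.
have inv0 B : walsh c0 (symd [set v] B) = walsh c0 B.
  by apply: walsh_invariant => A vA; rewrite /c0 /sect0 vA.
have inv1 B : walsh c1 (symd [set v] B) = walsh c1 B.
  by apply: walsh_invariant => A vA; rewrite /c1 /sect1 vA.
have -> : \sum_A c A ^+ 2 = \sum_A c0 A ^+ 2 + \sum_A c1 A ^+ 2.
  rewrite (sum_sect v); congr (_ + _); apply: eq_bigr => A _.
    by rewrite /c0 /sect0; case: ifP; rewrite ?expr0n.
  by rewrite /c1 /sect1; case: ifP; rewrite ?expr0n.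
set a := \sum_A c0 A ^+ 2 in S2 S4 *; set b := \sum_A c1 A ^+ 2 in R2 R4 *.
set s := walsh c0 in S2 S4 inv0 *; set r := walsh c1 in R2 R4 inv1 *.
have sgs B : sg R v B ^+ 2 = 1 by rewrite expr2 sg_sqr.
have a0 : 0 <= a by apply: sumr_ge0 => A _; exact: sqr_ge0.
have b0 : 0 <= b by apply: sumr_ge0 => A _; exact: sqr_ge0.
split.
  have -> : avg (fun B => walsh c B ^+ 2) =
      avg (fun B => s B ^+ 2 + r B ^+ 2 + sg R v B * (2 * s B * r B)).
    apply: eq_avg => B; rewrite (walsh_sect v) -/s -/r sqrrD exprMn sgs; ring.
  rewrite !avgD avg_sg0 ?addr0 ?S2 ?R2 // => B; by rewrite inv0 inv1.
have -> : avg (fun B => walsh c B ^+ 4) =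
    avg (fun B => s B ^+ 4 + 6 * (s B ^+ 2 * r B ^+ 2) + r B ^+ 4 +
                  sg R v B * (4 * s B ^+ 3 * r B + 4 * s B * r B ^+ 3)).
  apply: eq_avg => B; rewrite (walsh_sect v) -/s -/r; have := sgs B.
  move: (sg R v B) (s B) (r B) => e x y e2.
  have -> : (x + e * y) ^+ 4 = x ^+ 4 + 6 * (x ^+ 2 * y ^+ 2) * e ^+ 2 +
     y ^+ 4 * (e ^+ 2) ^+ 2 + e * (4 * x ^+ 3 * y + 4 * x * y ^+ 3 * e ^+ 2) by ring.
  by rewrite e2 expr1n !mulr1.
rewrite !avgD avgZ [X in _ + X]avg_sg0 ?addr0; last by move=> B; rewrite inv0 inv1.
(* One ninth under the square root gives [1 / 3], so [6 s^2 r^2] averages to at most the cross term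
   [2 * 9 ^+ D * a * b] of the square. *)
have SR : avg (fun B => s B ^+ 2 * r B ^+ 2) <= 9 ^+ D / 3 * (a * b).
  rewrite -ler_sqr ?nnegrE; last 2 first.
  - by apply: avg_ge0 => B; rewrite mulr_ge0 ?sqr_ge0.
  - by rewrite !mulr_ge0 ?invr_ge0 ?exprn_ge0.
  apply: le_trans (cauchy_schwarz_avg _ _) _.
  under [X in X * _]eq_avg do rewrite -exprM.
  under [X in _ * X]eq_avg do rewrite -exprM.
  have -> : (9 ^+ D / 3 * (a * b)) ^+ 2 =
    (9 ^+ D * a ^+ 2) * ((9 ^+ D * b ^+ 2) / 9) by field.
  apply: ler_pM => //; try by apply: avg_ge0 => B; exact: exprn_even_ge0.
  by rewrite ler_pdivlMr // mulrC.
have -> : 9 ^+ D * (a + b) ^+ 2 =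
  9 ^+ D * a ^+ 2 + 6 * (9 ^+ D / 3 * (a * b)) + 9 ^+ D * b ^+ 2 by field.
rewrite lerD ?lerD ?ler_wpM2l //.
apply: le_trans R4; rewrite ler_peMl ?ler1n //.
by apply: avg_ge0 => B; exact: exprn_even_ge0.
Qed.

(* With [s] of order [sigma 3^D], integrate [|x| >= x^2/s - x^4/s^3]. *)
Lemma walsh_L1 D c : (forall A, c A != 0 -> (#|A| <= D)%N) ->
  3 / 8 / 3 ^+ D * Num.sqrt (\sum_A c A ^+ 2) <= avg (fun B => `|walsh c B|).
Proof.
move=> cD; have [|E2 E4] := @walsh_moments setT D c.
  by move=> A /cD ->; rewrite subsetT.
have c2 : 0 <= \sum_A c A ^+ 2 by apply: sumr_ge0 => A _; exact: sqr_ge0.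
set s := Num.sqrt _; have s2 : s ^+ 2 = \sum_A c A ^+ 2 by rewrite sqr_sqrtr.
have [->|s0] := eqVneq s 0; first by rewrite mulr0; apply: avg_ge0.
have {}s0 : 0 < s by rewrite lt0r s0 sqrtr_ge0.
have t0 : 0 < 3 ^+ D :> R by rewrite exprn_gt0.
set q : R := 3 ^+ D in t0 *; have q2 : 9 ^+ D = q ^+ 2.
  by rewrite /q -exprM mulnC exprM; congr (_ ^+ _); ring.
rewrite -s2 in E2 E4; rewrite q2 in E4.
(* For this [u] the averages of [x^2 / u] and [x^4 / u^3] are [s / (2 q)] and at most [s / (8 q)],
   whence the constant [3 / 8]. *)
set u := 2 * q * s; have u0 : 0 < u by rewrite !mulr_gt0.
apply: (@le_trans _ _ (avg (fun B => walsh c B ^+ 2 * u^-1 + walsh c B ^+ 4 * - u^-1 ^+ 3))).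
  rewrite avgD !avgZr E2 mulrN.
  apply: (@le_trans _ _ (s ^+ 2 / u - q ^+ 2 * (s ^+ 2) ^+ 2 * u^-1 ^+ 3)); last first.
    by rewrite lerD2l lerN2 ler_wpM2r // exprn_ge0 // invr_ge0 ltW.
  by rewrite /u le_eqVlt; apply/orP; left; apply/eqP; field; rewrite !gt_eqF.
apply: ler_avg => B; rewrite -[walsh c B ^+ 4](@ger0_norm _ (_ ^+ 4)) ?exprn_even_ge0 //.
rewrite -[walsh c B ^+ 2]ger0_norm ?sqr_ge0 // !normrX.
move: `|_| (normr_ge0 (walsh c B)) => x x0.
have -> : x ^+ 2 * u^-1 + x ^+ 4 * - u^-1 ^+ 3 = u * ((x / u) ^+ 2 - (x / u) ^+ 4).
  by field; rewrite gt_eqF.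
have {3}-> : x = u * (x / u) by field; rewrite gt_eqF.
rewrite ler_pM2l //; have : 0 <= x / u by rewrite divr_ge0 // ltW.
move: (x / u) => y y0; rewrite -subr_ge0.
have [y1|y1] := lerP y 1.
  have -> : y - (y ^+ 2 - y ^+ 4) = y * (1 - y) + y ^+ 4 by ring.
  by rewrite addr_ge0 ?mulr_ge0 ?subr_ge0 ?exprn_ge0.
have -> : y - (y ^+ 2 - y ^+ 4) = y + y ^+ 2 * (y - 1) * (y + 1) by ring.
by rewrite addr_ge0 ?mulr_ge0 ?subr_ge0 ?sqr_ge0 ?addr_ge0 // ltW.
Qed.

End Bonami.

(** * Polynomials bounded on an interval *)

Section Polynomials.
Variable R : realType.

(* [2^(k+1) p(t/2) - p(t)] kills the top coefficient of [p] and does not decrease the others. *)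
Lemma coef_bound k : exists2 c : R, 1 <= c &
  forall (p : {poly R}) (Q : R), (size p <= k.+1)%N ->
    (forall t, 0 <= t <= 1 -> `|p.[t]| <= Q) -> forall j, `|p`_j| <= c * Q.
Proof.
elim: k => [|k [c c1 IH]].
  exists 1 => // p Q sp pQ j; rewrite mul1r.
  have := pQ 0; rewrite lexx ler01 => /(_ isT) h0.
  have Q0 := le_trans (normr_ge0 _) h0.
  case: j => [|j]; first by rewrite -horner_coef0.
  by rewrite nth_default ?normr0 // (leq_trans sp).
set z : R := 2 ^+ k.+1 + 1; exists (1 + k.+1%:R * (c * z)).
  rewrite lerDl !mulr_ge0 ?addr_ge0 ?exprn_ge0 //; lra.
move=> p Q sp pQ.
have Q0 : 0 <= Q.
  by have := pQ 0; rewrite lexx ler01 => /(_ isT); apply: le_trans.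
have z1 : 1 <= z by rewrite lerDr exprn_ge0.
pose r := \poly_(j < k.+1) (p`_j * (2 ^+ (k.+1 - j) - 1)).
have rQ t : 0 <= t <= 1 -> `|r.[t]| <= z * Q.
  case/andP=> t0 t1.
  have -> : r.[t] = 2 ^+ k.+1 * p.[t / 2] - p.[t].
    rewrite horner_poly !(horner_coef_wide _ sp) mulr_sumr -sumrB.
    rewrite [in RHS]big_ord_recr /= [X in _ = _ + X](_ : _ = 0) ?addr0; last first.
      have : 2 ^+ k.+1 != 0 :> R by rewrite expf_neq0 ?pnatr_eq0.
      by rewrite expr_div_n; move: (2 ^+ k.+1) (t ^+ k.+1) => x y x0; field.
    apply: eq_bigr => -[j jk] _ /=.
    have -> : 2 ^+ k.+1 = 2 ^+ (k.+1 - j) * 2 ^+ j :> R.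
      by rewrite -exprD subnK // ltnW.
    have : 2 ^+ j != 0 :> R by rewrite expf_neq0 ?pnatr_eq0.
    rewrite expr_div_n; move: (2 ^+ j) (2 ^+ (k.+1 - j)) (t ^+ j) => x y z' x0; by field.
  apply: le_trans (ler_normB _ _) _; rewrite mulrDl mul1r normrM normrX normr_nat.
  apply: lerD; last by apply: pQ; rewrite t0.
  by apply: ler_wpM2l; rewrite ?exprn_ge0 //; apply: pQ; lra.
have pj j : (j <= k)%N -> `|p`_j| <= c * z * Q.
  move=> jk; have := IH r (z * Q) (size_poly _ _) rQ j.
  rewrite coef_poly ltnS jk normrM mulrA; apply: le_trans.
  rewrite ler_peMr // ger0_norm ?subr_ge0 ?exprn_ege1 ?ler1n //.
  rewrite lerBrDr subSn // exprS; have : 1 <= 2 ^+ (k - j) :> R.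
    by rewrite exprn_ege1 ?ler1n.
  lra.
move=> j; have cz0 : 0 <= c * z * Q by rewrite !mulr_ge0 //; lra.
have [jk|kj] := leqP j k.
  apply: le_trans (pj _ jk) _; rewrite mulrDl mul1r mulr_natl mulrnAl mulrS.
  by rewrite addrCA lerDl addr_ge0 // mulrn_wge0.
have [jk|jk] := leqP j k.+1; last first.
  rewrite nth_default ?normr0; last exact: leq_trans jk.
  by rewrite mulrDl mul1r addr_ge0 // mulr_natl mulrnAl mulrn_wge0.
have -> : j = k.+1 by apply/eqP; rewrite eqn_leq jk kj.
(* The top coefficient is [p(1)] minus all the others. *)
have := horner_coef_wide 1 sp; rewrite big_ord_recr /= expr1n mulr1 => /eqP.
rewrite addrC -subr_eq => /eqP <-.
apply: le_trans (ler_normB _ _) _; rewrite mulrDl mul1r lerD //.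
  by apply: pQ; rewrite ler01 lexx.
apply: le_trans (ler_norm_sum _ _ _) _.
have -> : k.+1%:R * (c * z) * Q = \sum_(i < k.+1) c * z * Q.
  by rewrite sumr_const card_ord mulr_natl mulrnAl.
apply: ler_sum => i _.
by rewrite expr1n mulr1 pj // -ltnS.
Qed.

(** By [coef_bound] the terms of degree at least [2] contribute at most a multiple of [(b - a) t^2].
    The first inequality is the bound [a] read at [- t], the second the bound [b] read at [t]. *)
Lemma poly_slope_bound k : exists2 c : R, 1 <= c &
  forall (p : {poly R}) (a b : R), (size p <= k.+1)%N -> a <= 0 <= b ->
    (forall t, -1 <= t <= 1 -> a <= p.[t] <= b) ->
    forall t, 0 <= t <= 1 ->
      p`_1 * t <= p`_0 - a + c * (b - a) * t ^+ 2 /\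
      p`_1 * t <= b - p`_0 + c * (b - a) * t ^+ 2.
Proof.
have [c c1 cP] := coef_bound k; exists (1 + k%:R * c).
  by rewrite lerDl mulr_ge0 //; lra.
move=> p a b sp /andP[a0 b0] pab.
have pj j : `|p`_j| <= c * (b - a).
  apply: cP => // t /andP[t0 t1]; have /andP[] : a <= p.[t] <= b by apply: pab; lra.
  by move=> ? ?; rewrite ler_norml; lra.
have rem t : -1 <= t <= 1 -> `|p.[t] - p`_0 - p`_1 * t| <= k%:R * c * (b - a) * t ^+ 2.
  move=> /andP[t0 t1]; rewrite (@horner_coef_wide _ k.+2) ?(leq_trans sp) //.
  rewrite !big_ord_recl /= /bump /= expr0 expr1 mulr1.
  set S := \sum_(i < k) _; have -> : p`_0 + (p`_1 * t + S) - p`_0 - p`_1 * t = S by ring.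
  rewrite {}/S.
  apply: le_trans (ler_norm_sum _ _ _) _.
  have -> : k%:R * c * (b - a) * t ^+ 2 = \sum_(i < k) c * (b - a) * t ^+ 2.
    by rewrite sumr_const card_ord mulr_natl !mulrnAl.
  apply: ler_sum => i _.
  rewrite normrM !add1n normrX -addn2 exprD real_normK ?num_real // mulrA.
  apply: ler_wpM2r; rewrite ?sqr_ge0 //; set x := `|p`_ _|.
  apply: (@le_trans _ _ x); last exact: pj.
  by rewrite ler_piMr ?normr_ge0 ?exprn_ile1 // ler_norml t0.
move=> t /andP[t0 t1]; have t2 := sqr_ge0 t.
have h : 0 <= (b - a) * t ^+ 2 by rewrite mulr_ge0 //; lra.
split.
  have : `|p.[- t] - p`_0 - p`_1 * - t| <= k%:R * c * (b - a) * (- t) ^+ 2.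
    by apply: rem; lra.
  rewrite ler_norml => /andP[_].
  have /andP[+ _] : a <= p.[- t] <= b by apply: pab; lra.
  rewrite sqrrN !mulrDl; nra.
have : `|p.[t] - p`_0 - p`_1 * t| <= k%:R * c * (b - a) * t ^+ 2.
  by apply: rem; lra.
rewrite ler_norml => /andP[+ _].
have /andP[_] : a <= p.[t] <= b by apply: pab; lra.
rewrite !mulrDl; nra.
Qed.

(** The choice [t = X / (2 c Q)] is optimal; it is at most [1] because the case [t = 1] of the
    hypothesis gives [X <= D + c Q <= 2 c Q]. *)
Lemma sqr_le_of_parabola (X D Q c : R) : 0 <= X -> 0 <= D <= Q -> 1 <= c ->
  (forall t, 0 <= t <= 1 -> X * t <= D + c * Q * t ^+ 2) -> X ^+ 2 <= 4 * c * Q * D.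
Proof.
move=> X0 /andP[D0 DQ] c1 h.
have [Q0|Q0] := eqVneq Q 0.
  have := h 1; rewrite ler01 lexx mulr1 => /(_ isT).
  rewrite Q0 !(mulr0, mul0r, addr0) => XD.
  by rewrite (_ : X = 0) ?expr0n /= ?lexx //; lra.
have {}Q0 : 0 < Q by rewrite lt0r Q0 (le_trans D0).
have cQ : 0 < 2 * c * Q by rewrite !mulr_gt0 //; lra.
have t1 : X / (2 * c * Q) <= 1.
  rewrite ler_pdivrMr // mul1r; have : Q <= c * Q by rewrite ler_peMl // ltW.
  by have := h 1; rewrite ler01 lexx mulr1 expr1n mulr1 => /(_ isT); lra.
have := h (X / (2 * c * Q)); rewrite t1 divr_ge0 ?(ltW cQ) // => /(_ isT).
have -> : X * (X / (2 * c * Q)) = 2 * X ^+ 2 / (4 * c * Q).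
  field; rewrite gt_eqF //= gt_eqF //; lra.
have -> : D + c * Q * (X / (2 * c * Q)) ^+ 2 = D + X ^+ 2 / (4 * c * Q).
  field; rewrite gt_eqF //= gt_eqF //; lra.
rewrite -lerBlDr -mulrBl ler_pdivrMr; last by rewrite !mulr_gt0 //; lra.
move=> {}h; apply: le_trans (le_trans h _); lra.
Qed.

End Polynomials.

(** * Signed transversals and Walsh coefficients *)

Section PermSets.
Variable T : finType.
Implicit Types (s : {perm T}) (e S : {set T}).

Lemma imset_permM s s' e : (s * s')%g @: e = s' @: (s @: e).
Proof. by rewrite -imset_comp; apply: eq_imset => t; rewrite permM. Qed.

Lemma imset_permK s e : s @: (s^-1%g @: e) = e.
Proof. by rewrite -imset_permM mulVg -[RHS]imset_id; apply: eq_imset => t; rewrite perm1. Qed.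

Lemma mem_imset_perm s e t : (s t \in s @: e) = (t \in e).
Proof. by rewrite mem_imset //; exact: perm_inj. Qed.

Lemma card_imset_perm s e : #|s @: e| = #|e|.
Proof. by rewrite card_imset //; exact: perm_inj. Qed.

Lemma imset_fix s e : {in e, s =1 id} -> s @: e = e.
Proof. by move=> se; rewrite (eq_in_imset se) imset_id. Qed.

Lemma sum_kset_perm (R : realType) (k : nat) s (G : {set T} -> R) :
  \sum_(e : {set T} | #|e| == k) G (s @: e) = \sum_(e : {set T} | #|e| == k) G e.
Proof.
rewrite [RHS](reindex_inj (imset_inj (@perm_inj _ s))) /=.
by apply: eq_bigl => e; rewrite card_imset_perm.
Qed.

Lemma exchange_points (A B : {set T}) a : #|A| = #|B| -> a \in A :\: B ->
  exists2 b, b \in B :\: A & #|(b |: A :\ a) :\: B| = #|A :\: B|.-1 /\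
    #|b |: A :\ a| = #|B|.
Proof.
move=> cAB aAB.
have /card_gt0P[b bBA] : (0 < #|B :\: A|)%N.
  have : (0 < #|A :\: B|)%N by apply/card_gt0P; exists a.
  by rewrite !cardsD setIC cAB.
exists b => //; move: (aAB) (bBA); rewrite !inE => /andP[aB aA] /andP[bA bB].
split.
  rewrite [in RHS](cardsD1 a) aAB; apply: eq_card => t; rewrite !inE.
  by case: (eqVneq t b) => [->|_] /=; rewrite ?bB ?(negPf bA) ?andbF // andbCA.
by rewrite cardsU1 !inE (negPf bA) andbF -cAB [in RHS](cardsD1 a) aA.
Qed.

(** A chain of transpositions, each trading a point of [A :\: B] for one of [B :\: A]. Points on
    which [A] and [B] agree never move, which later keeps chosen pairs fixed. *)
Lemma exists_perm_imset (A B : {set T}) : #|A| = #|B| ->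
  exists s, s @: A = B /\ forall t, (t \in A) = (t \in B) -> s t = t.
Proof.
move: {2}#|A :\: B| (erefl #|A :\: B|) => N; elim: N A => [|N IH] A.
  move/eqP; rewrite cards_eq0 setD_eq0 => AB cAB; exists 1%g.
  have -> : A = B by apply/eqP; rewrite eqEcard AB cAB leqnn.
  by split=> [|t _]; rewrite ?perm1 // imset_fix // => t _; rewrite perm1.
move=> cN cAB; have [a aAB] : exists a, a \in A :\: B by apply/card_gt0P; rewrite cN.
have [b bBA [cN' cA']] := exchange_points cAB aAB.
rewrite cN /= in cN'; have [s [sA' sfix]] := IH _ cN' cA'.
move: aAB bBA; rewrite !inE => /andP[aB aA] /andP[bA bB].
have ab : a != b by apply: contraNneq aB => ->.
have tA : tperm a b @: A = b |: A :\ a.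
  apply/setP => t; rewrite -[in LHS](tpermK a b t) mem_imset_perm !inE.
  case: tpermP => [->|->|/eqP/negPf-> /eqP/negPf->] //.
  - by rewrite (negPf bA) (negPf ab) eqxx.
  - by rewrite aA eqxx.
exists (tperm a b * s)%g; rewrite imset_permM tA; split=> // t tAB.
have ta : t != a by apply: contraNneq aB => E; rewrite -E -tAB E.
have tb : t != b by apply: contraNneq bA => E; rewrite -E tAB E.
rewrite permM tpermD 1?eq_sym // sfix // !inE (negPf ta) (negPf tb) //.
Qed.
End PermSets.

(** * Pair swaps and the Walsh coefficients they induce *)

Section Pairs.
Variables (R : realType) (m r k : nat).
Local Notation T := ('I_m * bool + 'I_r)%type.
Implicit Types (A B : {set 'I_m}) (e S : {set T}) (s al be : {perm T}).
Implicit Types (w u : {set T} -> R).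

Definition px (i : 'I_m) : T := inl (i, false).
Definition py (i : 'I_m) : T := inl (i, true).
Definition pt A : {set T} := [set t | if t is inl p then p.1 \in A else false].

Definition swap_fun B (t : T) : T :=
  if t is inl p then inl (p.1, p.2 (+) (p.1 \in B)) else t.

Lemma swap_funK B : involutive (swap_fun B).
Proof. by case=> [[i b]|j] //=; rewrite -addbA addbb addbF. Qed.

Definition sw B : {perm T} := perm (can_inj (swap_funK B)).

Lemma swE B t : sw B t = swap_fun B t. Proof. by rewrite permE. Qed.

Lemma swK B t : sw B (sw B t) = t. Proof. by rewrite !swE swap_funK. Qed.

Lemma swM B C : (sw B * sw C)%g = sw (symd B C).
Proof.
by apply/permP => -[[i b]|j]; rewrite permM !swE //= inE addbA.
Qed.

Lemma mem_sw B e t : (t \in sw B @: e) = (sw B t \in e).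
Proof. by rewrite -[in LHS](swK B t) mem_imset_perm. Qed.

(* The product sign of a set meeting every pair of [A] once, [0] for other sets. *)
Definition theta A e : R := \prod_(i in A) ((px i \in e)%:R - (py i \in e)%:R).

Lemma theta_sw A B e : theta A (sw B @: e) = chi R A B * theta A e.
Proof.
rewrite /chi /theta -big_split /=; apply: eq_bigr => i _.
rewrite !mem_sw !swE /= /sg; case: (i \in B); rewrite ?mulN1r ?mul1r ?opprB //.
Qed.

Lemma theta_fix A s e : {in pt A, s =1 id} -> theta A (s @: e) = theta A e.
Proof.
move=> sA; apply: eq_bigr => i iA.
by rewrite -{1}(sA (px i)) ?inE // -{1}(sA (py i)) ?inE // !mem_imset_perm.
Qed.

Lemma theta_sqr A e : theta A e ^+ 2 = (theta A e != 0)%:R.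
Proof.
have [->|t0] := eqVneq; first by rewrite expr0n.
rewrite /theta -prodrXl /= big1 // => i iA; move/prodf_neq0: t0 => /(_ i iA).
by case: (_ \in e); case: (_ \in e); rewrite ?subrr ?eqxx // ?subr0 ?sub0r ?sqrrN expr1n.
Qed.

Lemma theta_neq0 A e : theta A e != 0 -> {in A, forall i, (px i \in e) = (py i \notin e)}.
Proof.
move/prodf_neq0 => h i /h; case: (_ \in e); case: (_ \in e) => //=; by rewrite subrr eqxx.
Qed.

Lemma sw_set1_fix i e : (px i \in e) = (py i \in e) -> sw [set i] @: e = e.
Proof.
move=> xy; apply/setP => t; rewrite mem_sw swE.
case: t => [[j b]|] //=; rewrite in_set1; case: eqP => [->|_]; rewrite ?addbF //.
by case: b; rewrite -?[inl (i, true)]/(py i) -?[inl (i, false)]/(px i) xy.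
Qed.

Lemma theta_eq0 A e : theta A e = 0 ->
  exists2 i, i \in A & sw [set i] @: e = e.
Proof.
move/eqP/prodf_eq0 => [i iA xy]; exists i => //; apply: sw_set1_fix.
by move: xy; case: (_ \in e); case: (_ \in e); rewrite ?subrr ?subr0 ?sub0r ?oppr_eq0 ?oner_eq0.
Qed.

(** Each vertex lies in at most one pair, so [e] meets at most [#|e|] pairs. *)
Lemma exists_pair_missed A e : (#|e| < #|A|)%N -> exists2 i, i \in A & sw [set i] @: e = e.
Proof.
move=> eA; have /card_gt0P[i0 _] : (0 < #|A|)%N by apply: leq_ltn_trans eA.
(* [i0] is a dummy value for the unpaired vertices. *)
pose g (t : T) := if t is inl p then p.1 else i0.
have /subsetPn[i iA ige] : ~~ (A \subset g @: e).
  by apply: contraL eA => /subset_leq_card Ag; rewrite -leqNgt (leq_trans Ag) ?leq_imset_card.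
exists i => //; apply: sw_set1_fix; transitivity false; last symmetry; apply: contraNF ige => h;
  by apply/imsetP; eexists; first exact: h.
Qed.

(** Each argument carries its own bijection, so that [w] and [u] can be averaged independently. *)
Definition inp w u al be := \sum_(e : {set T} | #|e| == k) w (al @: e) * u (be @: e).
(* [mathcomp] composes from left to right: [sw B * al] swaps first. *)
Definition coef w u A al be := avg (fun B => chi R A B * inp w u (sw B * al)%g be).
Definition Msum w A al := \sum_(e : {set T} | #|e| == k) theta A e * w (al @: e).

Lemma coefE w u A al be : coef w u A al be =
  \sum_(e : {set T} | #|e| == k)
     avg (fun B => chi R A B * w (al @: (sw B @: e))) * u (be @: e).
Proof.
under eq_bigr do rewrite -avgZr.
rewrite -avg_sum; apply: eq_avg => B; rewrite mulr_sumr; apply: eq_bigr => e _.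
by rewrite imset_permM mulrA.
Qed.

Lemma coef_sw w u A C al be :
  coef w u A (sw C * al)%g be = chi R A C * coef w u A al be.
Proof.
rewrite /coef -[in RHS](avg_reindex _ (can_inj (symdK C))) -avgZ; apply: eq_avg => B /=.
rewrite chi_symd mulgA swM; have -> : symd B C = symd C B.
  by apply/setP => i; rewrite !inE addbC.
by rewrite !mulrA chi_sqr mul1r.
Qed.

(** Each [k]-set misses a pair of [A]; swapping this pair preserves the term and flips the
    character. *)
Lemma coef_deg w u A al be : (k < #|A|)%N -> coef w u A al be = 0.
Proof.
move=> kA; rewrite coefE big1 // => e /eqP ek.
have [|i iA ie] := @exists_pair_missed A e; first by rewrite ek.
rewrite (avg_chi0 iA) ?mul0r // => B; congr (w (_ @: _)).
by rewrite -swM imset_permM ie.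
Qed.

Lemma Msum_equivariant w A s (z : R) al :
  (forall e, theta A (s @: e) = z * theta A e) -> z * z = 1 ->
  Msum w A (s * al)%g = z * Msum w A al.
Proof.
move=> sz z1; rewrite /Msum -[in RHS](sum_kset_perm _ s) mulr_sumr.
by apply: eq_bigr => e _; rewrite imset_permM sz !mulrA z1 mul1r.
Qed.

(* A transversal [k]-set can be moved to any other one by pair swaps and a
   permutation fixing the pairs, so equivariance determines a function on
   [k]-sets up to a scalar. *)
Lemma theta_proportional A (psi : {set T} -> R) :
  (forall B e, psi (sw B @: e) = chi R A B * psi e) ->
  (forall s e, {in pt A, s =1 id} -> psi (s @: e) = psi e) ->
  forall e e', #|e| = #|e'| -> theta A e * psi e' = psi e * theta A e'.
Proof.
move=> psw pfix e e' ee'.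
(* Swapping a pair that [f] meets in zero or two vertices fixes [f] but flips the character, so
   [psi f = - psi f]. *)
have psi0 f : theta A f = 0 -> psi f = 0.
  move/theta_eq0 => [i iA fi]; have := psw [set i] f.
  rewrite fi chi_set1 iA => ?; lra.
have [t0|t0] := eqVneq (theta A e) 0; first by rewrite t0 (psi0 _ t0) !mul0r.
have [t0'|t0'] := eqVneq (theta A e') 0; first by rewrite t0' (psi0 _ t0') !mulr0.
(* Swapping the pairs of [B f] brings a transversal [f] to a normal form containing every [px] and
   no [py] of [A]; two sets in normal form differ only outside [pt A]. *)
pose B (f : {set T}) := [set i in A | py i \in f].
have Bpt f t : theta A f != 0 -> t \in pt A ->
    (t \in sw (B f) @: f) = (if t is inl p then ~~ p.2 else false).
  move=> f0; rewrite mem_sw swE; case: t => [[i b]|j]; rewrite inE //= => iA.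
  rewrite inE iA /=; have := theta_neq0 f0 iA; rewrite /px /py.
  by case: b; case E: (inl (i, true) \in f) => /=; rewrite ?E // => ->.
have [s [se sfix]] := @exists_perm_imset _ (sw (B e) @: e) (sw (B e') @: e')
  (etrans (card_imset_perm _ _) (etrans ee' (esym (card_imset_perm _ _)))).
have spt : {in pt A, s =1 id}.
  by move=> t tA; apply: sfix; rewrite !Bpt.
have := psw (B e') e'; have := theta_sw A (B e') e'.
rewrite -se theta_fix // pfix // theta_sw psw => E1 E2.
have := chi_sqr R A (B e); have := chi_sqr R A (B e').
move: (chi R A _) (chi R A _) E1 E2 => x y E1 E2 x2 y2.
have -> : theta A e' = x * (y * theta A e) by rewrite E1 mulrA x2 mul1r.
have -> : psi e' = x * (y * psi e) by rewrite E2 mulrA x2 mul1r.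
ring.
Qed.

(** Test [coef] against the sign [phi] of [Msum w A]. Averaging over [al] leaves a sum of [u]
    weighted by [psi], which inherits the equivariance of [theta A] and so is a multiple of it. The
    multiple is found by pairing [psi] with [theta A], which gives the mean of [|Msum w A|]. *)
Lemma coef_L1 w u A :
  avg (fun al => `|Msum w A al|) * avg (fun be => `|Msum u A be|) <=
  (\sum_(e : {set T} | #|e| == k) theta A e ^+ 2) *
    avg (fun be => avg (fun al => `|coef w u A al be|)).
Proof.
set Z := \sum_(e | _) _.
pose phi al := Num.sg (Msum w A al).
have phi_sw B al : phi (sw B * al)%g = chi R A B * phi al.
  rewrite /phi (Msum_equivariant _ _ (fun e => theta_sw A B e)) ?chi_sqr // sgrM.
  by congr (_ * _); rewrite -[RHS]mulr_sg_norm norm_chi mulr1.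
have phi_fix s al : {in pt A, s =1 id} -> phi (s * al)%g = phi al.
  move=> sA; rewrite /phi (@Msum_equivariant _ _ _ 1) ?mul1r //.
  by move=> e; rewrite theta_fix ?mul1r.
pose psi e := avg (fun al => w (al @: e) * phi al).
have psi_s s e : psi (s @: e) = avg (fun al => w (al @: e) * phi (s^-1 * al)%g).
  rewrite /psi -[RHS](avg_reindex _ (mulgI s)); apply: eq_avg => al /=.
  by rewrite mulKg imset_permM.
have psi_sw B e : psi (sw B @: e) = chi R A B * psi e.
  have -> : psi e = avg (fun al => w (al @: e) * phi (sw B * ((sw B)^-1 * al))%g).
    by apply: eq_avg => al; rewrite mulKVg.
  rewrite psi_s -avgZ; apply: eq_avg => al.
  by rewrite phi_sw mulrCA [chi _ _ _ * (chi _ _ _ * _)]mulrA chi_sqr mul1r.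
have psi_fix s e : {in pt A, s =1 id} -> psi (s @: e) = psi e.
  move=> sA; rewrite psi_s; apply: eq_avg => al; rewrite phi_fix // => t tA.
  by rewrite -{1}(sA t tA) permK.
have phi1 al : `|phi al| <= 1 by rewrite normr_sg lern1 leq_b1.
have cphi be : avg (fun al => coef w u A al be * phi al) =
    \sum_(e : {set T} | #|e| == k) psi e * u (be @: e).
  transitivity (avg (fun al => \sum_(e : {set T} | #|e| == k)
     avg (fun B => chi R A B * w (al @: (sw B @: e)) * phi al) * u (be @: e))).
    apply: eq_avg => al; rewrite coefE mulr_suml; apply: eq_bigr => e _.
    by rewrite avgZr mulrAC.
  rewrite avg_sum; apply: eq_bigr => e _; rewrite avgZr avg_exchange; congr (_ * _).
  rewrite -[RHS](avg_const (set0 : {set 'I_m})); apply: eq_avg => B /=.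
  under eq_avg do rewrite -mulrA.
  by rewrite avgZ -/(psi _) psi_sw mulrA chi_sqr mul1r.
have key be : Z * avg (fun al => coef w u A al be * phi al) =
    avg (fun al => `|Msum w A al|) * Msum u A be.
  rewrite cphi mulr_suml.
  transitivity (\sum_(e : {set T} | #|e| == k) theta A e * psi e * Msum u A be).
    apply: eq_bigr => e /eqP ek; rewrite /Msum !mulr_sumr; apply: eq_bigr => e' /eqP ek'.
    rewrite mulrA mulrA -[_ * theta A e']mulrA -(theta_proportional psi_sw psi_fix).
      by rewrite mulrA expr2.
    by rewrite ek ek'.
  rewrite -mulr_suml; congr (_ * _).
  under eq_bigr do rewrite -avgZ.
  rewrite -avg_sum; apply: eq_avg => al /=.
  rewrite normrEsg mulrC /Msum mulr_suml.
  by apply: eq_bigr => e _; rewrite mulrA.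
rewrite -avgZ -avgZ; apply: ler_avg => be.
have Z0 : 0 <= Z by apply: sumr_ge0 => e _; exact: sqr_ge0.
have -> : avg (fun al => `|Msum w A al|) * `|Msum u A be| =
   Z * `|avg (fun al => coef w u A al be * phi al)|.
  rewrite -[in RHS](ger0_norm Z0) -normrM key normrM ger0_norm //.
  exact: avg_ge0.
apply: ler_wpM2l => //; apply: le_trans (ler_norm_avg _) _; apply: ler_avg => al.
by rewrite normrM ler_piMr.
Qed.

End Pairs.

(** * The L1 Poincare inequality *)

Section Poincare.
Variables (R : realType) (m r k : nat).
Local Notation T := ('I_m * bool + 'I_r)%type.
Local Notation pt := (@pt m r).
Local Notation px := (@px m r).
Local Notation py := (@py m r).
Local Notation sw := (@sw m r).
Local Notation theta := (@theta R m r).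
Local Notation Msum := (@Msum R m r k).
Implicit Types (A B : {set 'I_m}) (e S : {set T}) (s al be : {perm T}).
Implicit Types (w u : {set T} -> R).

Lemma card_points : #|{: T}| = (m * 2 + r)%N.
Proof. by rewrite card_sum card_prod !card_ord card_bool. Qed.

Lemma card_pt A : #|pt A| = (2 * #|A|)%N.
Proof.
have -> : pt A = inl @: setX A [set: bool].
  apply/setP => -[[i b]|j]; rewrite inE /=.
    by rewrite mem_imset ?inE /= ?andbT // => ? ? [].
  by apply/esym/negbTE/imsetP => -[].
by rewrite card_imset ?cardsX ?cardsT ?card_bool 1?mulnC // => ? ? [].
Qed.

Lemma pt_setU1 A i : pt (i |: A) = px i |: (py i |: pt A).
Proof.
apply/setP => -[[j b]|j]; rewrite !inE //=.
rewrite /px /py; case: (eqVneq j i) => [->|ji] /=.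
  by case: b; rewrite ?eqxx ?orbT.
have N b' : (inl (j, b) == inl (i, b') :> T) = false.
  by apply/eqP => -[E _]; rewrite E eqxx in ji.
by rewrite !N.
Qed.

Definition rests A : {set {set T}} :=
  [set S : {set T} | (S \subset ~: pt A) && (#|S| == k - #|A|)%N].

Lemma card_rests A : #|rests A| = 'C(m * 2 + r - 2 * #|A|, k - #|A|).
Proof. by rewrite cards_draws cardsCs setCK card_pt card_points. Qed.

Lemma card_transversal A e : theta A e != 0 -> #|e :&: pt A| = #|A|.
Proof.
move=> /theta_neq0 t0; pose f i := if px i \in e then px i else py i.
have -> : e :&: pt A = f @: A.
  apply/setP => t; apply/idP/imsetP => [|[i iA ->]].
    rewrite !inE; case: t => [[i b]|j] /andP[te] //= iA; exists i => //.
    move: (t0 i iA) te; rewrite /f /px /py; case: b => [-> ->|_ ->] //.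
  rewrite inE /f; have := t0 i iA; case: (boolP (px i \in e)) => [-> _|_ /esym/negbFE ->];
    by rewrite inE.
rewrite card_imset // => i j; rewrite /f.
by case: ifP => _; case: ifP => _ [].
Qed.

Lemma rest_mem A e : #|e| = k -> theta A e != 0 -> e :\: pt A \in rests A.
Proof.
move=> ek t0; rewrite inE subsetDr /= -(card_transversal t0) -ek.
by rewrite cardsD.
Qed.

(** A transversal [k]-set is determined by the pairs of [A] from which it takes [py] and by its
    rest. *)
Lemma sum_theta_sqr A :
  \sum_(e : {set T} | #|e| == k) theta A e ^+ 2 <= (2 ^ #|A| * #|rests A|)%:R.
Proof.
under eq_bigr do rewrite theta_sqr.
rewrite -natr_sum ler_nat -big_mkcondr sum1_card -card_powerset -cardsX.
pose g e := ([set i in A | py i \in e], e :\: pt A).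
rewrite -[X in (X <= _)%N]cardsE -(@card_in_imset _ _ g) => [|e e'].
  apply/subset_leq_card/subsetP => _ /imsetP[e + ->].
  rewrite !inE => /andP[/eqP ek t0]; have := rest_mem ek t0; rewrite inE => ->.
  by rewrite andbT; apply/subsetP => i; rewrite inE => /andP[].
rewrite !inE => /andP[_ t0] /andP[_ t0'] [/setP E1 /setP E2].
apply/setP => t; have := E2 t; rewrite in_setD [in X in _ = X -> _]in_setD.
have [|//] := boolP (t \in pt A).
rewrite inE; case: t => [[i b]|//] /= iA _; have := E1 i; rewrite !inE iA /=.
case: b => // E; have := theta_neq0 t0 iA; have := theta_neq0 t0' iA.
by rewrite /px => -> ->; rewrite E.
Qed.

(* The alternating sum of [w] over the transversals of [A] extended by [S]. *)
Definition Delta w A al S :=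
  \sum_(e : {set T} | (#|e| == k) && (e :\: pt A == S)) theta A e * w (al @: e).

Lemma Msum_Delta w A al : Msum w A al = \sum_(S in rests A) Delta w A al S.
Proof.
rewrite /Msum (partition_big (fun e => e :\: pt A) xpredT) //=.
rewrite [RHS]big_mkcond /=; apply: eq_bigr => S _; case: ifPn => // SA.
rewrite big1 // => e /andP[/eqP ek /eqP eS].
have [->|t0] := eqVneq (theta A e) 0; first by rewrite mul0r.
by rewrite -eS rest_mem in SA.
Qed.

Lemma setD_eqU1 (x y : T) (P S e : {set T}) : x != y -> x \notin P -> y \notin P ->
  [disjoint S & x |: (y |: P)] ->
  (e :\: P == x |: S) = [&& x \in e, y \notin e & e :\: (x |: (y |: P)) == S].
Proof.
move=> xy xP yP dS.
have out t : t \in x |: (y |: P) -> t \in S = false by move=> /(disjointFl dS).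
have xS : x \in S = false by apply: out; rewrite !inE eqxx.
have yS : y \in S = false by apply: out; rewrite !inE eqxx orbT.
apply/eqP/and3P => [/setP E|[xe ye /eqP/setP E]].
  have := E x; have := E y; rewrite !inE xP yP xS yS eqxx eq_sym (negPf xy) /=.
  move=> ye xe; rewrite ye xe; split=> //; apply/eqP/setP => t; have := E t; rewrite !inE.
  case: (eqVneq t x) => [->|_] /=; first by rewrite xS.
  by case: (eqVneq t y) => [->|_] /=; first by rewrite yS.
apply/setP => t; have := E t; rewrite !inE.
case: (eqVneq t x) => [->|_] /=; first by rewrite xP xe.
by case: (eqVneq t y) => [->|_] //=; rewrite (negPf ye) yS andbF.
Qed.

Lemma px_neq_py i : px i != py i.
Proof. by apply/eqP => -[]. Qed.

Lemma px_notin A i : i \notin A -> px i \notin pt A.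
Proof. by rewrite inE. Qed.

Lemma py_notin A i : i \notin A -> py i \notin pt A.
Proof. by rewrite inE. Qed.

(** A transversal of [i |: A] takes exactly one of [px i] and [py i], with opposite signs. Thus
    [Delta] for one more pair is a discrete derivative of [Delta] for [A]. *)
Lemma Delta_setU1 w A i al S : i \notin A -> S \subset ~: pt (i |: A) ->
  Delta w (i |: A) al S = Delta w A al (px i |: S) - Delta w A al (py i |: S).
Proof.
move=> iA; rewrite -disjoints_subset pt_setU1 => dS; rewrite /Delta !big_mkcondr -sumrB.
have [xA yA] := (px_notin iA, py_notin iA).
have xy := px_neq_py i.
apply: eq_bigr => e _; rewrite pt_setU1 (setD_eqU1 e xy xA yA dS).
rewrite setUCA in dS; have yx : py i != px i by rewrite eq_sym.
rewrite (setD_eqU1 e yx yA xA dS) [px i |: (py i |: _)]setUCA.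
rewrite /theta big_setU1 //=.
by case: (px i \in e); case: (py i \in e); case: (_ == S) => /=;
  rewrite ?subrr ?subr0 ?sub0r ?mul0r ?mul1r ?mulN1r ?mulNr ?subrr.
Qed.

Lemma Delta_perm w A s al S : {in pt A, s =1 id} ->
  Delta w A (s * al)%g S = Delta w A al (s @: S).
Proof.
move=> sA; rewrite /Delta !big_mkcondr -[RHS](sum_kset_perm _ s).
apply: eq_bigr => e _; rewrite theta_fix // imset_permM.
have -> : s @: e :\: pt A = s @: (e :\: pt A).
  apply/setP => t; rewrite -[t](permKV s) in_setD !mem_imset_perm in_setD.
  by rewrite -{1}(imset_fix sA) mem_imset_perm.
by rewrite (inj_eq (imset_inj (@perm_inj _ s))).
Qed.

(** Lets any two vertices outside [pt A] play the part of the pair [i]. The second transposition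
    acts at [y'], the place of [py i] after the first. *)
Lemma exists_perm_pair A i a b : i \notin A -> a \notin pt A -> b \notin pt A ->
  a != b -> exists s : {perm T}, [/\ {in pt A, s =1 id}, s (px i) = a & s (py i) = b].
Proof.
move=> iA aA bA ab; pose y' := tperm (px i) a (py i).
have xy := px_neq_py i.
have y'a : y' != a by rewrite /y' -[X in _ != X](tpermL (px i)) (inj_eq perm_inj) eq_sym.
exists (tperm (px i) a * tperm y' b)%g; split.
- move=> t tA; have out (z : T) : z \notin pt A -> z != t by apply: contraNneq => ->.
  rewrite permM (tpermD (out _ (px_notin iA)) (out _ aA)) tpermD ?out //.
  by rewrite /y'; case: tpermP; rewrite ?px_notin ?py_notin.
- by rewrite permM tpermL tpermD // eq_sym.
- by rewrite permM -/y' tpermL.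
Qed.

Section Step.
Variables (w : {set T} -> R) (A : {set 'I_m}) (i : 'I_m) (d : R).
Hypothesis iA : i \notin A.
Hypothesis dP : forall S, S \in rests (i |: A) ->
  avg (fun al => `|Delta w (i |: A) al S|) <= d.

(** Carrying the pair [i] to [a] and [b] turns this difference into a value of [Delta] for [i |: A],
    and the average over [al] absorbs the relabelling. *)
Lemma Delta_edge S a b : S \in rests A -> a \in S -> b \notin pt A -> b \notin S ->
  avg (fun al => `|Delta w A al S - Delta w A al (b |: S :\ a)|) <= d.
Proof.
rewrite inE => /andP[SA /eqP Sk] aS bA bS.
have aA : a \notin pt A by have := subsetP SA a aS; rewrite inE.
have ab : a != b by apply: contraNneq bS => <-.
have [s [sA sx sy]] := exists_perm_pair iA aA bA ab.
pose S1 := s^-1%g @: (S :\ a).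
have sS1 : s @: S1 = S :\ a by rewrite imset_permK.
have S1r : S1 \in rests (i |: A).
  rewrite inE card_imset_perm cardsU1 iA add1n; apply/andP; split; last first.
    by rewrite (cardsD1 a) aS in Sk; rewrite subnS -Sk.
  rewrite -disjoints_subset disjoint_sym disjoints_subset; apply/subsetP => t tp.
  rewrite inE -(mem_imset_perm s) sS1 !inE; move: tp; rewrite pt_setU1 !inE.
  case/orP=> [/eqP->|/orP[/eqP->|tA]]; rewrite ?sx ?eqxx // ?sy ?(negPf bS) ?andbF //.
  have {}tA : t \in pt A by rewrite inE.
  rewrite sA // negb_and negbK; apply/orP; right.
  by apply: contraL tA => /(subsetP SA); rewrite inE.
have S1i : S1 \subset ~: pt (i |: A) by move: S1r; rewrite inE => /andP[].
rewrite -(avg_reindex _ (mulgI s^-1%g)).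
apply: le_trans (dP S1r); apply: ler_avg => al /=.
rewrite Delta_setU1 //.
have E x S' : Delta w A al (x |: S1) = Delta w A (s^-1 * al)%g (s x |: S :\ a).
  by rewrite -sS1 -imsetU1 -Delta_perm // mulKVg.
by rewrite !E // sx sy setD1K.
Qed.

Lemma Delta_path j S S' : S \in rests A -> S' \in rests A -> #|S :\: S'| = j ->
  avg (fun al => `|Delta w A al S - Delta w A al S'|) <= j%:R * d.
Proof.
elim: j S => [|j IH] S SA SA' => [/eqP|cj].
  move: SA SA'; rewrite cards_eq0 setD_eq0 !inE => /andP[_ /eqP c1] /andP[_ /eqP c2] sub.
  have -> : S = S' by apply/eqP; rewrite eqEcard sub c1 c2 leqnn.
  by rewrite mul0r; under eq_avg do rewrite subrr normr0; rewrite (avg_const (1%g : {perm T})).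
have [a aSS] : exists a, a \in S :\: S' by apply/card_gt0P; rewrite cj.
move: (SA) (SA'); rewrite !inE => /andP[sub /eqP c1] /andP[sub' /eqP c2].
have [|b bSS [cb cb']] := exchange_points _ aSS; first by rewrite c1 c2.
move: aSS bSS; rewrite !inE => /andP[aS' aS] /andP[bS bS'].
have bA : b \notin pt A by have := subsetP sub' b bS'; rewrite inE.
have S2 : b |: S :\ a \in rests A.
  rewrite inE cb' c2 eqxx andbT subUset sub1set inE bA /=.
  exact: subset_trans (subD1set _ _) sub.
rewrite cj /= in cb; have h := IH _ S2 SA' cb.
rewrite -natr1 mulrDl mul1r addrC.
apply: le_trans (lerD (Delta_edge SA aS bA bS) h); rewrite -avgD; apply: ler_avg => al.
by rewrite -[in leLHS](subrKA (Delta w A al (b |: S :\ a))) ler_normD.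
Qed.

(** The L1 Poincare inequality: [Delta] at [S] is its mean over all rests, [Msum / #|rests A|], plus
    the mean of its differences, and any two rests are at most [k - #|A|] exchanges apart. *)
Lemma Delta_bound S : 0 <= d -> S \in rests A ->
  avg (fun al => `|Delta w A al S|) <=
  avg (fun al => `|Msum w A al|) / #|rests A|%:R + (k - #|A|)%:R * d.
Proof.
move=> d0 SA; have N0 : 0 < #|rests A|%:R :> R by rewrite ltr0n; apply/card_gt0P; exists S.
rewrite -(ler_pM2r N0) mulrDl divfK ?gt_eqF // -avgZr.
apply: (@le_trans _ _ (avg (fun al => `|Msum w A al| +
    \sum_(S' in rests A) `|Delta w A al S - Delta w A al S'|))).
  apply: ler_avg => al; rewrite -[X in `|_| * X]normr_nat -normrM.
  have -> : Delta w A al S * #|rests A|%:R = Msum w A al +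
      \sum_(S' in rests A) (Delta w A al S - Delta w A al S').
    by rewrite sumrB -Msum_Delta sumr_const mulr_natr addrC subrK.
  by apply: le_trans (ler_normD _ _) _; rewrite lerD2l ler_norm_sum.
rewrite avgD lerD2l avg_sum mulr_natr -sumr_const; apply: ler_sum => S' SA'.
apply: le_trans (Delta_path SA SA' erefl) _; apply: ler_wpM2r => //.
by move: SA; rewrite ler_nat inE => /andP[_ /eqP <-]; rewrite subset_leq_card ?subsetDl.
Qed.

End Step.

Definition ini d : {set 'I_m} := [set i : 'I_m | (i < d)%N].

Lemma card_ini d : (d <= m)%N -> #|ini d| = d.
Proof.
move=> dm; have wI : injective (widen_ord dm) by move=> x y /(congr1 val) /= /val_inj.
rewrite -[RHS]card_ord -(card_imset _ wI).
apply: eq_card => i; rewrite inE; apply/idP/imsetP => [id|[j _ ->]]; last exact: (ltn_ord j).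
by exists (Ordinal id) => //; apply: val_inj.
Qed.

(** Descent from [k] pairs, dropping one pair at a time with [Delta_bound]; each step costs a factor
    of at most [1 + k]. *)
Lemma Delta_chain w (eta : R) : (k <= m)%N -> 0 <= eta ->
  (forall d, (d <= k)%N ->
    avg (fun al => `|Msum w (ini d) al|) <= eta * #|rests (ini d)|%:R) ->
  forall j, (j <= k)%N -> forall S, S \in rests (ini (k - j)) ->
    avg (fun al => `|Delta w (ini (k - j)) al S|) <= (1 + k%:R) ^+ j * eta.
Proof.
move=> km eta0 hM; elim=> [|j IH] jk S SA.
  (* At level [k] the only rest is [set0], so [Delta] coincides with [Msum]. *)
  have rest0 S' : S' \in rests (ini (k - 0)) -> S' = set0.
    by rewrite subn0 inE card_ini // subnn cards_eq0 => /andP[_ /eqP].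
  have E : rests (ini (k - 0)) = [set S].
    by apply/setP => S'; rewrite in_set1; apply/idP/eqP => [/rest0->|-> //]; rewrite (rest0 S).
  have := hM (k - 0)%N; rewrite expr0 mul1r E cards1 mulr1 => /(_ (leq_subr _ _)).
  by under eq_avg do rewrite Msum_Delta E big_set1.
have jm : (k - j.+1 < m)%N by apply: leq_trans km; rewrite ltn_subrL (leq_trans _ jk).
pose i := Ordinal jm.
have iA : i \notin ini (k - j.+1) by rewrite inE ltnn.
have Ai : i |: ini (k - j.+1) = ini (k - j).
  by apply/setP => l; rewrite !inE -val_eqE /=; lia.
have cA : #|ini (k - j.+1)| = (k - j.+1)%N by rewrite card_ini // ltnW.
set d := (1 + k%:R) ^+ j * eta in IH *.
have k1 : 1 <= (1 + k%:R) ^+ j :> R by rewrite exprn_ege1 // lerDl.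
have d0 : 0 <= d by rewrite mulr_ge0 // (le_trans ler01).
have := @Delta_bound w _ i d iA _ S d0 SA; rewrite Ai => /(_ (IH (ltnW jk))) h.
apply: le_trans h _; rewrite cA subKn // exprS -mulrA mulrDl mul1r.
apply: lerD; last by rewrite ler_wpM2r // ler_nat.
apply: (@le_trans _ _ eta); last by rewrite ler_peMl.
rewrite ler_pdivrMr ?hM ?leq_subr // ltr0n; apply/card_gt0P; by exists S.
Qed.

(** A permutation of the pairs carrying [A] to [B] lifts to the vertices, and the average over [al]
    absorbs it. *)
Lemma avg_Msum_card w A B : #|A| = #|B| ->
  avg (fun al => `|Msum w A al|) = avg (fun al => `|Msum w B al|).
Proof.
move=> /exists_perm_imset[th [<- _]].
pose f (t : T) : T := if t is inl p then inl (th p.1, p.2) else t.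
have fI : injective f.
  case=> [[i b]|j] [[i' b']|j'] //= [].
    by move=> /perm_inj-> ->.
rewrite -[LHS](avg_reindex _ (mulgI (perm fI))); apply: eq_avg => al /=.
congr `|_|; rewrite /Msum -[in RHS](sum_kset_perm _ (perm fI)).
apply: eq_bigr => e _; rewrite imset_permM; congr (_ * _).
rewrite /theta [RHS]big_imset /=; last by move=> ? ? _ _; exact: perm_inj.
apply: eq_bigr => i _.
have E b : (inl (th i, b) : T) = perm fI (inl (i, b)) by rewrite permE.
by rewrite /px /py !E !mem_imset_perm.
Qed.

Lemma avg_orbit (f : {set T} -> R) S : #|S| = k ->
  'C(#|{: T}|, k)%:R * avg (fun al : {perm T} => f (al @: S)) =
  \sum_(e : {set T} | #|e| == k) f e.
Proof.
move=> Sk; rewrite -card_draws -sum1_card natr_sum mulr_suml.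
transitivity (\sum_(e : {set T} | #|e| == k) avg (fun al : {perm T} => f (al @: e))).
  apply: eq_big => e; rewrite inE // => /eqP ek.
  have [|s [<- _]] := @exists_perm_imset _ S e; first by rewrite Sk ek.
  rewrite mul1r -[LHS](avg_reindex _ (mulgI s)); apply: eq_avg => al /=.
  by rewrite imset_permM.
rewrite -avg_sum -[RHS](avg_const (1%g : {perm T})); apply: eq_avg => al.
exact: (sum_kset_perm _ al).
Qed.

(** Otherwise [Msum] is small on average at levels [1] to [k], and at level [0] it is the total
    weight [0]. [Delta_chain] then bounds the mean of [|w|] by [1 / 2], while it equals [1]; this
    fixes the constant. *)
Lemma exists_level w : (1 <= k <= m)%N ->
  \sum_(e : {set T} | #|e| == k) w e = 0 ->
  \sum_(e : {set T} | #|e| == k) `|w e| = 'C(m * 2 + r, k)%:R ->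
  exists2 d, (1 <= d <= k)%N & forall A, #|A| = d ->
    (2 * (1 + k%:R) ^+ k)^-1 * #|rests A|%:R <= avg (fun al => `|Msum w A al|).
Proof.
case/andP=> k1 km w0 w1; set c := (_ * _)^-1.
have p0 : 0 < (1 + k%:R) ^+ k :> R by rewrite exprn_gt0 // ltr_wpDr.
have c0 : 0 < c by rewrite invr_gt0 mulr_gt0.
have [/existsP[d /andP[d1 dM]]|] := boolP [exists d : 'I_k.+1,
   (0 < d)%N && (c * #|rests (ini d)|%:R <= avg (fun al => `|Msum w (ini d) al|))].
  have dk : (d <= k)%N by rewrite -ltnS.
  exists d => [|A Ad]; first by rewrite d1.
  have Ed : #|A| = #|ini d| by rewrite card_ini // (leq_trans dk).
  by rewrite (avg_Msum_card _ Ed) card_rests Ed -card_rests.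
move/existsPn => hM; exfalso.
have ini0 : ini 0 = set0 by apply/setP => i; rewrite !inE.
have small d : (d <= k)%N ->
    avg (fun al => `|Msum w (ini d) al|) <= c * #|rests (ini d)|%:R.
  move=> dk; have [->|d0] := posnP d; last first.
    have /= := hM (Ordinal (dk : (d < k.+1)%N)); rewrite d0 /= -ltNge; exact: ltW.
  rewrite ini0; apply: (@le_trans _ _ 0); last by rewrite mulr_ge0 // ltW.
  rewrite -[leRHS](avg_const (1%g : {perm T})); apply: ler_avg => al.
  rewrite /Msum; under eq_bigr do rewrite /theta big_set0 mul1r.
  by rewrite (sum_kset_perm _ al) w0 normr0.
have kT : (k <= #|{: T}|)%N by rewrite card_points; lia.
have pt0 : pt set0 = set0 by apply/setP => -[[i b]|j]; rewrite !inE.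
have /card_gt0P[S Sr] : (0 < #|rests (ini (k - k))|)%N.
  by rewrite card_rests subnn ini0 cards0 bin_gt0; lia.
have := Delta_chain km (ltW c0) small (leqnn k) Sr.
move: Sr; rewrite subnn ini0 inE pt0 cards0 subn0 => /andP[_ /eqP Sk].
have E al : Delta w set0 al S = w (al @: S).
  rewrite /Delta pt0 (big_pred1 S) => [|e]; first by rewrite /theta big_set0 mul1r.
  by rewrite setD0; apply/andP/eqP => [[_ /eqP]|->] //; rewrite Sk.
under eq_avg do rewrite E.
have := avg_orbit (fun e => `|w e|) Sk; rewrite w1 card_points.
have C0 : 0 < 'C(m * 2 + r, k)%:R :> R by rewrite ltr0n bin_gt0 -card_points.
move/(canRL (mulKf (lt0r_neq0 C0))) => ->; rewrite mulVf ?gt_eqF //.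
have -> : (1 + k%:R) ^+ k * c = 2^-1 by rewrite /c; field; rewrite gt_eqF.
lra.
Qed.

End Poincare.

(** * Slopes and greedy swaps *)

Section Slopes.
Variables (R : realType) (m r k : nat).
Local Notation T := ('I_m * bool + 'I_r)%type.
Local Notation sw := (@sw m r).
Local Notation theta := (@theta R m r).
Local Notation Msum := (@Msum R m r k).
Local Notation inp := (@inp R m r k).
Local Notation coef := (@coef R m r k).
Variables (w u : {set T} -> R) (I : {set 'I_m}).
Implicit Types (A B : {set 'I_m}) (al be : {perm T}) (i : 'I_m).

(* The derivative in pair [i] at the point where the other pairs of [I] are
   swapped with probability [1/2] and the pairs outside [I] are not swapped. *)
Definition slope i al be := \sum_(A : {set 'I_m} | A :&: I == [set i]) coef w u A al be.

Lemma card_family i d : i \in I -> (0 < d)%N ->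
  ('C(m - #|I|, d.-1) <= #|[set A : {set 'I_m} | (A :&: I == [set i]) && (#|A| == d)]|)%N.
Proof.
move=> iI d0; have -> : (m - #|I| = #|~: I|)%N by rewrite [#|~: I|]cardsCs setCK card_ord.
rewrite -cards_draws -(@card_in_imset _ _ (fun A => i |: A)); last first.
  move=> A B; rewrite !inE => /andP[/subsetP AI _] /andP[/subsetP BI _] E.
  have iN (C : {set 'I_m}) : {subset C <= ~: I} -> i \notin C.
    by move=> CI; apply: contraL iI => /CI; rewrite inE.
  by rewrite -(setU1K (iN _ AI)) E setU1K ?iN.
apply/subset_leq_card/subsetP => _ /imsetP[A + ->].
rewrite !inE => /andP[AI /eqP Ad].
have iA : i \notin A by apply: contraL iI => /(subsetP AI); rewrite inE.
rewrite cardsU1 iA Ad add1n prednK // eqxx andbT setIUl.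
have -> : A :&: I = set0 by apply/eqP; rewrite setI_eq0 disjoints_subset.
by rewrite setU0; apply/eqP/setIidPl; rewrite sub1set.
Qed.

(** Composing [al] with random swaps turns [slope] into a Walsh polynomial with coefficients [coef],
    of degree at most [k], to which [walsh_L1] applies. Cauchy-Schwarz over the sets of size [d]
    bounds the l2 norm of the coefficients below by their l1 norm. *)
Lemma slope_L1 d (Y : R) i : i \in I -> (0 < d)%N -> 0 <= Y ->
  (forall A, #|A| = d -> Y <= avg (fun be => avg (fun al => `|coef w u A al be|))) ->
  3 / 8 / 3 ^+ k * Num.sqrt ('C(m - #|I|, d.-1)%:R) * Y <=
    avg (fun be => avg (fun al => `|slope i al be|)).
Proof.
move=> iI d0 Y0 hY; set c2 := 3 / 8 / 3 ^+ k.
have c20 : 0 <= c2 by rewrite !mulr_ge0 ?invr_ge0 ?exprn_ge0.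
set fam := [set A : {set 'I_m} | (A :&: I == [set i]) && (#|A| == d)].
apply: (@le_trans _ _ (c2 * Num.sqrt #|fam|%:R * Y)).
  by rewrite ler_wpM2r // ler_wpM2l // ler_sqrt ?ler_nat ?card_family.
have [f0|f0] := eqVneq (Num.sqrt #|fam|%:R : R) 0.
  by rewrite f0 mulr0 mul0r; apply: avg_ge0 => be; exact: avg_ge0.
have {}f0 : 0 < Num.sqrt #|fam|%:R :> R by rewrite lt0r f0 sqrtr_ge0.
pose c al be A := if A :&: I == [set i] then coef w u A al be else 0.
have cs al be : (\sum_(A in fam) `|coef w u A al be|) / Num.sqrt #|fam|%:R <=
    Num.sqrt (\sum_A c al be A ^+ 2).
  rewrite ler_pdivrMr // -sqrtrM; last by apply: sumr_ge0 => A _; exact: sqr_ge0.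
  rewrite -[leLHS]ger0_norm ?sumr_ge0 // -sqrtr_sqr ler_sqrt; last first.
    by rewrite mulr_ge0 // sumr_ge0 // => A _; exact: sqr_ge0.
  have := cauchy_schwarz_sum (mem fam) (fun A => `|coef w u A al be|) (fun=> 1).
  under eq_bigr do rewrite mulr1; move/le_trans; apply.
  rewrite [X in _ * X](_ : _ = #|fam|%:R); last first.
    by under eq_bigr do rewrite expr1n; rewrite sumr_const.
  apply: ler_wpM2r => //; rewrite big_mkcond /=; apply: ler_sum => A _.
  rewrite inE /c; case: ifP => [/andP[-> _]|_]; last exact: sqr_ge0.
  by rewrite real_normK ?num_real.
apply: (@le_trans _ _ (avg (fun be => avg (fun al =>
    c2 * ((\sum_(A in fam) `|coef w u A al be|) / Num.sqrt #|fam|%:R))))).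
  under eq_avg do rewrite avgZ avgZr avg_sum.
  rewrite avgZ avgZr avg_sum -mulrA; apply: ler_wpM2l => //.
  rewrite ler_pdivlMr // mulrAC -expr2 sqr_sqrtr // mulr_natl -sumr_const.
  by apply: ler_sum => A; rewrite inE => /andP[_ /eqP]; exact: hY.
apply: ler_avg => be.
have -> : avg (fun al => `|slope i al be|) =
    avg (fun al => avg (fun C => `|walsh (c al be) C|)).
  rewrite avg_exchange -[LHS](avg_const (set0 : {set 'I_m})); apply: eq_avg => C.
  rewrite -[LHS](avg_reindex _ (mulgI (sw C))); apply: eq_avg => al /=.
  congr `|_|; rewrite /slope /walsh big_mkcond /=; apply: eq_bigr => A _.
  by rewrite coef_sw /c; case: ifP; rewrite ?mul0r // mulrC.
apply: ler_avg => al; apply: (@le_trans _ _ (c2 * Num.sqrt (\sum_A c al be A ^+ 2))).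
  by apply: ler_wpM2l.
apply: walsh_L1 => A; rewrite /c; case: ifP => _; last by rewrite eqxx.
by apply: contraR; rewrite -ltnNge => kA; rewrite coef_deg.
Qed.

Section Greedy.
Variables (al be : {perm T}).

(* The mean of [inp w u] when each pair of [I] is independently left unswapped
   with probability [(1 + t * sign of its slope) / 2]. *)
Definition greedy_poly : {poly R} :=
  \sum_(A : {set 'I_m})
     (coef w u A al be * \prod_(i in A :&: I) Num.sg (slope i al be)) *: 'X^#|A :&: I|.

Lemma size_greedy_poly : (size greedy_poly <= k.+1)%N.
Proof.
apply: leq_trans (size_sum _ _ _) _; apply/bigmax_leqP => A _.
have [kA|Ak] := ltnP k #|A|; first by rewrite coef_deg // mul0r scale0r size_poly0.
apply: leq_trans (size_scale_leq _ _) _; rewrite size_polyXn ltnS.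
exact: leq_trans (subset_leq_card (subsetIl _ _)) Ak.
Qed.

Lemma greedy_poly_bounds (a b t : R) : (forall al be, a <= inp w u al be <= b) ->
  -1 <= t <= 1 -> a <= greedy_poly.[t] <= b.
Proof.
move=> hab /andP[t0 t1].
(* The value [1] means never swapped: pairs outside [I] stay put. *)
pose eps i := if i \in I then t * Num.sg (slope i al be) else 1.
have -> : greedy_poly.[t] = \sum_A coef w u A al be * \prod_(i in A) eps i.
  rewrite horner_sum; apply: eq_bigr => A _; rewrite hornerZ hornerXn -mulrA; congr (_ * _).
  rewrite -prodr_const -big_split [in RHS](bigID (fun i => i \in I)) /=.
  rewrite [X in _ = _ * X]big1 ?mulr1 => [|i /andP[_ /negPf iI]]; last by rewrite /eps iI.
  apply: eq_big => [i|i]; rewrite inE // => /andP[_ iI]; by rewrite /eps iI mulrC.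
apply: (multilinear_bounds (h := fun B => inp w u (sw B * al)%g be)) => // i.
rewrite /eps; case: ifP => _; last by rewrite lexx andbT lerN10 || lra.
by case: sgrP => _; rewrite ?mulr0 ?mulr1 ?mulrN1; lra.
Qed.

(** Degree [1] selects the sets [A] that meet [I] in one pair [i]; these sum to the slope of [i]
    times its own sign. *)
Lemma greedy_poly1 : greedy_poly`_1 = \sum_(i in I) `|slope i al be|.
Proof.
rewrite coef_sum.
under [RHS]eq_bigr do rewrite normrEsg /slope mulr_sumr big_mkcond.
rewrite exchange_big /=; apply: eq_bigr => A _; rewrite coefZ coefXn eq_sym.
have [/cards1P[j Aj]|A1] := boolP (#|A :&: I| == 1)%N; last first.
  rewrite mulr0 big1 // => i _; case: eqP => // E.
  by rewrite E cards1 in A1.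
have jI : j \in I by have /setIP[] : j \in A :&: I by rewrite Aj set11.
rewrite Aj big_set1 mulr1 [RHS](bigD1 j) //= eqxx [X in _ = _ + X]big1 ?addr0 1?mulrC //.
move=> i /andP[_ ij]; case: eqP => // /set1_inj E; by rewrite E eqxx in ij.
Qed.

Lemma greedy_poly0 : greedy_poly`_0 = \sum_(A : {set 'I_m} | A :&: I == set0) coef w u A al be.
Proof.
rewrite coef_sum [RHS]big_mkcond; apply: eq_bigr => A _; rewrite coefZ coefXn eq_sym cards_eq0.
by case: eqP => [->|_]; rewrite ?mulr0 // big_set0 !mulr1.
Qed.

End Greedy.

Lemma avg_inp be : (k <= #|{: T}|)%N -> \sum_(e : {set T} | #|e| == k) w e = 0 ->
  avg (fun al => inp w u al be) = 0.
Proof.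
move=> kT w0; rewrite avg_sum big1 // => e /eqP ek; rewrite avgZr.
have C0 : 'C(#|{: T}|, k)%:R != 0 :> R by rewrite pnatr_eq0 -lt0n bin_gt0.
by rewrite (canRL (mulKf C0) (avg_orbit w ek)) w0 mulr0 mul0r.
Qed.

Lemma avg_coef A be : (k <= #|{: T}|)%N -> \sum_(e : {set T} | #|e| == k) w e = 0 ->
  avg (fun al => coef w u A al be) = 0.
Proof.
move=> kT w0.
rewrite /coef avg_exchange -[RHS](avg_const (set0 : {set 'I_m})); apply: eq_avg => B.
rewrite avgZ -[RHS](mulr0 (chi R A B)) -(avg_inp be kT w0); congr (_ * _).
by rewrite (avg_reindex (inp w u ^~ be) (mulgI (sw B))).
Qed.

End Slopes.

(** * Combining the estimates *)

(** The binomial is a product of [b] ratios [(a - i) / (b - i)], each at least [x] because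
    [x >= 1]. *)
Lemma expr_le_bin (R : realType) (x : R) (a b : nat) :
  1 <= x -> x * b%:R <= a%:R -> x ^+ b <= 'C(a, b)%:R.
Proof.
move=> x1; elim: b a => [|b IH] a; first by rewrite bin0 expr0.
case: a => [|a] h; first by move: h; rewrite leNgt mulr_gt0 ?ltr0n ?(lt_le_trans ltr01).
have b0 : 0 < b.+1%:R :> R by rewrite ltr0n.
rewrite -(ler_pM2l b0) -natrM -mul_bin_diag natrM exprS mulrA.
apply: ler_pM; rewrite ?mulr_ge0 ?exprn_ge0 //; try lra.
by apply: IH; move: h; rewrite -[b.+1%:R]natr1 -[a.+1%:R]natr1; nra.
Qed.

Section Combine.
Variables (R : realType) (m r k : nat).
Local Notation T := ('I_m * bool + 'I_r)%type.
Local Notation Msum := (@Msum R m r k).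
Local Notation coef := (@coef R m r k).
Local Notation rests := (@rests m r k).
Implicit Types (A : {set 'I_m}) (w u : {set T} -> R) (al be : {perm T}).

Lemma coef_L1_level w u A (c N : R) : 0 <= c -> 0 < N -> #|rests A|%:R = N ->
  c * N <= avg (fun al => `|Msum w A al|) -> c * N <= avg (fun al => `|Msum u A al|) ->
  c ^+ 2 * N / 2 ^+ #|A| <= avg (fun be => avg (fun al => `|coef w u A al be|)).
Proof.
move=> c0 N0 EN hw hu; set Y := avg _.
have Y0 : 0 <= Y by apply: avg_ge0 => be; exact: avg_ge0.
have cN : 0 <= c * N by rewrite mulr_ge0 // ltW.
have := le_trans (ler_pM cN cN hw hu) (coef_L1 _ w u A).
move/le_trans => /(_ _ (ler_wpM2r Y0 (sum_theta_sqr _ _ _ _))).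
rewrite natrM EN natrX ler_pdivrMr ?exprn_gt0 // => h.
rewrite -(ler_pM2l N0); apply: le_trans (le_trans _ h) _; first by rewrite le_eqVlt; apply/orP; left; apply/eqP; ring.
by rewrite le_eqVlt; apply/orP; left; apply/eqP; rewrite -/Y; ring.
Qed.

End Combine.

(** Averaged over [al] and [be], the greedy polynomial has constant term [0] and linear coefficient
    [X], so [poly_slope_bound] puts the line [X t] below two parabolas, starting at [- a] and at
    [b]. *)
Lemma slopes_upper (R : realType) k : exists2 c : R, 0 < c &
  forall m r (w u : {set 'I_m * bool + 'I_r} -> R) (I : {set 'I_m}) (a b : R),
  let T := ('I_m * bool + 'I_r)%type in
  (k <= #|{: T}|)%N -> \sum_(e : {set T} | #|e| == k) w e = 0 ->
  (forall al be, a <= inp k w u al be <= b) -> a <= 0 <= b ->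
  (\sum_(i in I) avg (fun be => avg (fun al => `|slope k w u I i al be|))) ^+ 2 <=
    c * (b * - a).
Proof.
have [c c1 cP] := poly_slope_bound R k; exists (8 * c); first by lra.
move=> m r w u I a b T kT w0 hab ab; have /andP[a0 b0] := ab.
set X := \sum_(i in I) _.
have X0 : 0 <= X by apply: sumr_ge0 => i _; apply: avg_ge0 => be; exact: avg_ge0.
pose p al be := greedy_poly k w u I al be.
have p1 : avg (fun be => avg (fun al => (p al be)`_1)) = X.
  under eq_avg do under eq_avg do rewrite greedy_poly1.
  under eq_avg do rewrite avg_sum.
  by rewrite avg_sum.
have p0 : avg (fun be => avg (fun al => (p al be)`_0)) = 0.
  under eq_avg do under eq_avg do rewrite greedy_poly0.
  under eq_avg do rewrite avg_sum.
  rewrite avg_sum big1 // => A _; rewrite -[RHS](avg_const (1%g : {perm T})).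
  by apply: eq_avg => be; exact: avg_coef.
have avgc (x : R) : avg (fun _ : {perm T} => avg (fun _ : {perm T} => x)) = x.
  by rewrite !(avg_const (1%g : {perm T})).
have bounds al be t : 0 <= t <= 1 -> (p al be)`_1 * t <=
      (p al be)`_0 + (- a + c * (b - a) * t ^+ 2) /\
    (p al be)`_1 * t <= -1 * (p al be)`_0 + (b + c * (b - a) * t ^+ 2).
  move=> t01; have [||h1 h2] := cP (p al be) a b _ ab _ t t01.
  - exact: size_greedy_poly.
  - by move=> s s1; exact: greedy_poly_bounds.
  by split; lra.
have up1 t : 0 <= t <= 1 -> X * t <= - a + c * (b - a) * t ^+ 2.
  move=> t01; rewrite -p1 -avgZr -[leRHS]add0r -{2}p0 -[X in _ + X]avgc -avgD.
  apply: ler_avg => be; rewrite -avgZr -avgD; apply: ler_avg => al.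
  by case: (bounds al be t t01).
have up2 t : 0 <= t <= 1 -> X * t <= b + c * (b - a) * t ^+ 2.
  move=> t01; rewrite -p1 -avgZr -[leRHS]add0r -{2}[0](mulr0 (-1)) -{2}p0.
  rewrite -[X in _ + X]avgc -avgZ -avgD.
  apply: ler_avg => be; rewrite -avgZr -avgZ -avgD; apply: ler_avg => al.
  by case: (bounds al be t t01).
(* The parabola that starts at the smaller of [b] and [- a] is used; [b - a] is at most twice the
   larger, so their product appears, with constant [8 c]. *)
have [ba|ba] := lerP b (- a).
  have h2 := @sqr_le_of_parabola R X b (b - a) c X0 _ c1 up2.
  apply: le_trans (h2 _) _; first lra.
  have : 0 <= c * b by rewrite mulr_ge0 //; lra.
  nra.
have h1 := @sqr_le_of_parabola R X (- a) (b - a) c X0 _ c1 up1.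
apply: le_trans (h1 _) _; first lra.
have : 0 <= c * - a by rewrite mulr_ge0 //; lra.
nra.
Qed.

Lemma exists_subset_card (V : finType) q : (q <= #|V|)%N -> exists I : {set V}, #|I| = q.
Proof.
move=> qV; have : (0 < #|[set A : {set V} | #|A| == q]|)%N by rewrite card_draws bin_gt0.
by case/card_gt0P => A; rewrite inE => /eqP; exists A.
Qed.

(** One quantity [y], linear in the number of vertices, serves as lower scale for the number of
    pairs in [I], the number of sets [A] per slope and the number of rests. *)
Lemma level_arith (R : realType) (m r k d : nat) : (1 <= k <= m)%N -> (r < 2)%N ->
  (1 <= d <= k)%N ->
  let y : R := (m * 2 + r)%:R / (6 * k%:R) in
  [/\ y <= (m %/ k)%:R, y ^+ d.-1 <= 'C(m - m %/ k, d.-1)%:R,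
      1 <= 'C(m * 2 + r - 2 * d, k - d)%:R :> R &
      y ^+ (k - d) <= 'C(m * 2 + r - 2 * d, k - d)%:R].
Proof.
case/andP=> k1 km r2 /andP[d1 dk] y; set n := (m * 2 + r)%N in y *.
have k0 : 0 < k%:R :> R by rewrite ltr0n.
have y0 : 0 <= y by rewrite divr_ge0 ?mulr_ge0 // ltW.
have q1 : (0 < m %/ k)%N by rewrite divn_gt0.
have mq : (m < (m %/ k).+1 * k)%N by rewrite ltn_ceil.
have qm : (m %/ k * k <= m)%N by exact: leq_trunc_div.
split.
- rewrite ler_pdivrMr ?mulr_gt0 // -!natrM ler_nat /n.
  nia.
(* [y] can be below [1], so [expr_le_bin] is applied to the larger ratio [m / k]. Taking [m %/ k]
   pairs for [I] leaves enough others. *)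
- pose x : R := m%:R / k%:R.
  have x1 : 1 <= x by rewrite ler_pdivlMr // mul1r ler_nat.
  apply: (@le_trans _ _ (x ^+ d.-1)).
    apply: lerXn2r; rewrite ?nnegrE //; first by lra.
    rewrite /x ler_pdivlMr // /y.
    have -> : n%:R / (6 * k%:R) * k%:R = n%:R / 6 :> R by field; rewrite gt_eqF.
    rewrite ler_pdivrMr // -natrM ler_nat /n; lia.
  apply: expr_le_bin => //; rewrite /x mulrAC ler_pdivrMr // -!natrM ler_nat.
  nia.
- by rewrite ler1n bin_gt0 /n; lia.
pose x : R := n%:R / k%:R.
have x1 : 1 <= x by rewrite ler_pdivlMr // mul1r ler_nat /n; lia.
apply: (@le_trans _ _ (x ^+ (k - d))).
  apply: lerXn2r; rewrite ?nnegrE //; first by lra.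
  rewrite /x /y invfM mulrCA ler_piMl ?divr_ge0 ?(ltW k0) //; lra.
apply: expr_le_bin => //; rewrite /x mulrAC ler_pdivrMr // -!natrM ler_nat /n.
nia.
Qed.

(** The powers of [y] come from the square of [#|I|], from the number of coefficients in a slope and
    from the number of rests. *)
Lemma split_exponent d k : (1 <= d <= k)%N -> k.+1 = (2 + d.-1 + (k - d))%N.
Proof. lia. Qed.

(** Compares the lower bound [slope_L1], summed over the [m %/ k] pairs of [I], with the upper bound
    [slopes_upper]. *)
Lemma pair_bound (R : realType) k (c : R) : 0 < c -> exists2 c' : R, 0 < c' &
  forall m r d (w u : {set 'I_m * bool + 'I_r} -> R) (a b : R),
  (1 <= k <= m)%N -> (r < 2)%N -> (1 <= d <= k)%N ->
  \sum_(e : {set 'I_m * bool + 'I_r} | #|e| == k) w e = 0 ->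
  (forall A : {set 'I_m}, #|A| = d ->
    c * #|rests r k A|%:R <= avg (fun al => `|Msum k w A al|) /\
    c * #|rests r k A|%:R <= avg (fun al => `|Msum k u A al|)) ->
  (forall al be, a <= inp k w u al be <= b) ->
  a <= 0 <= b /\ c' * (m * 2 + r)%:R ^+ k.+1 <= b * - a.
Proof.
move=> c0; have [C C0 CP] := slopes_upper R k.
have [k0|k0] : k = 0%N \/ (0 < k)%N by case: (k); [left|right].
  by exists 1 => // m r d w u a b; rewrite {1}k0 ltnn.
set c2 : R := 3 / 8 / 3 ^+ k.
have c20 : 0 < c2 by rewrite !divr_gt0 ?exprn_gt0.
pose K := (c2 * (c ^+ 2 / 2 ^+ k)) ^+ 2.
have K0 : 0 < K by rewrite exprn_gt0 // mulr_gt0 // divr_gt0 ?exprn_gt0.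
have k60 : 0 < 6 * k%:R :> R by rewrite mulr_gt0 ?ltr0n.
exists (K / C / (6 * k%:R) ^+ k.+1).
  by apply: divr_gt0; [apply: divr_gt0 | rewrite exprn_gt0].
move=> m r d w u a b km r2 dk w0 lev hab.
have [h1 h2 h3 h4] := level_arith R km r2 dk.
have kT : (k <= #|{: 'I_m * bool + 'I_r}|)%N.
  by rewrite card_points; case/andP: km; lia.
(* [inp] has mean [0] over [al], so its bounds lie on both sides of [0]. *)
have ab : a <= 0 <= b.
  rewrite -(avg_inp u (1%g : {perm _}) kT w0).
  rewrite -[X in X <= _ <= _](avg_const (1%g : {perm 'I_m * bool + 'I_r})).
  rewrite -[X in _ <= _ <= X](avg_const (1%g : {perm 'I_m * bool + 'I_r})).
  by apply/andP; split; apply: ler_avg => al; case/andP: (hab al 1%g).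
split=> //.
set y : R := (m * 2 + r)%:R / (6 * k%:R) in h1 h2 h4 *.
have y0 : 0 <= y by rewrite divr_ge0 // ltW.
have [I Iq] : exists I : {set 'I_m}, #|I| = (m %/ k)%N.
  by apply: exists_subset_card; rewrite card_ord leq_div.
have := CP m r w u I a b kT w0 hab ab; set X := \sum_(i in I) _ => hX.
set Nf : R := 'C(m - m %/ k, d.-1)%:R in h2.
set N : R := 'C(m * 2 + r - 2 * d, k - d)%:R in h3 h4.
have N0 : 0 < N by apply: lt_le_trans h3.
pose Y := c ^+ 2 * N / 2 ^+ k.
have Y0 : 0 <= Y by rewrite divr_ge0 ?exprn_ge0 // mulr_ge0 ?sqr_ge0 // ltW.
have hY (A : {set 'I_m}) : #|A| = d ->
    Y <= avg (fun be => avg (fun al => `|coef k w u A al be|)).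
  move=> Ad; have [l1 l2] := lev A Ad.
  have EN : #|rests r k A|%:R = N by rewrite card_rests Ad.
  rewrite EN in l1 l2; apply: le_trans (coef_L1_level (ltW c0) N0 EN l1 l2).
  rewrite /Y Ad; apply: ler_wpM2l; first by rewrite mulr_ge0 ?sqr_ge0 ?(ltW N0).
  by rewrite lef_pV2 ?posrE ?exprn_gt0 // ler_weXn2l ?ler1n //; case/andP: dk.
have d0 : (0 < d)%N by case/andP: dk.
have lowX : (m %/ k)%:R * (c2 * Num.sqrt Nf * Y) <= X.
  rewrite -Iq mulr_natl -sumr_const; apply: ler_sum => i iI.
  by rewrite /Nf -Iq; exact: slope_L1 hY.
have s0 : 0 <= Num.sqrt Nf := sqrtr_ge0 _.
have low0 : 0 <= (m %/ k)%:R * (c2 * Num.sqrt Nf * Y).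
  by apply: mulr_ge0 => //; apply: mulr_ge0 => //; apply: mulr_ge0 => //; exact: ltW.
have X0 := le_trans low0 lowX.
have {}hX : ((m %/ k)%:R * (c2 * Num.sqrt Nf * Y)) ^+ 2 <= C * (b * - a).
  by apply: le_trans hX; rewrite ler_sqr.
have E : ((m %/ k)%:R * (c2 * Num.sqrt Nf * Y)) ^+ 2 =
    K * ((m %/ k)%:R ^+ 2 * Nf * N ^+ 2).
  have -> : Nf = Num.sqrt Nf ^+ 2 by rewrite sqr_sqrtr.
  by rewrite sqrtr_sqr ger0_norm // /K /Y; ring.
have -> : K / C / (6 * k%:R) ^+ k.+1 * (m * 2 + r)%:R ^+ k.+1 = K * y ^+ k.+1 / C.
  by rewrite /y expr_div_n; field; rewrite !expf_neq0 ?gt_eqF.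
rewrite ler_pdivrMr // [leRHS]mulrC; apply: le_trans hX; rewrite E ler_pM2l //.
clearbody y; rewrite (split_exponent dk).
rewrite !exprD.
apply: ler_pM; rewrite ?mulr_ge0 ?exprn_ge0 //.
  by apply: ler_pM; rewrite ?exprn_ge0 // ler_sqr ?nnegrE.
(* The coefficients enter squared, but one factor [N >= 1] is given up. *)
apply: le_trans h4 _; rewrite expr2 ler_peMl //; exact: ltW.
Qed.

(** * Transport from the model with pairs to ['I_n] *)

Section Transport.
Variables (R : realType) (n m r k : nat).
Local Notation T := ('I_m * bool + 'I_r)%type.
Hypothesis nE : n = (m * 2 + r)%N.
Implicit Types (w u : hgraph R n).

Definition label (t : T) : 'I_n :=
  cast_ord (etrans (card_points m r) (esym nE)) (enum_rank t).

Lemma label_inj : injective label.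
Proof. by move=> x y /cast_ord_inj /enum_rank_inj. Qed.

Definition pull w (e : {set T}) : R := w (label @: e).

Lemma sum_pull (G : {set 'I_n} -> R) :
  \sum_(e : {set T} | #|e| == k) G (label @: e) = \sum_(e : {set 'I_n} | #|e| == k) G e.
Proof.
have card_eq : #|{set T}| = #|{set 'I_n}|.
  by rewrite -![#|{set _}|]cardsT -!powersetT !card_powerset !cardsT card_ord card_points nE.
rewrite [RHS](reindex (fun e : {set T} => label @: e)).
  by apply: eq_bigl => e; rewrite card_imset //; exact: label_inj.
apply: onW_bij; apply: inj_card_bij (imset_inj label_inj) _.
by rewrite card_eq.
Qed.

(** Only [al^-1 * be] matters, and [label] conjugates it to a permutation of ['I_n]. *)
Lemma inp_pull w u al be : exists pi,
  inp k (pull w) (pull u) al be = inner k (wperm w pi) u.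
Proof.
have [g gK Kg] : bijective label.
  by apply: inj_card_bij label_inj _; rewrite card_ord card_points nE.
have pI : injective (fun t => label ((al^-1 * be)%g (g t))).
  by move=> x y /label_inj /perm_inj /(can_inj Kg).
exists (perm pI); rewrite /inner -sum_pull -[RHS](sum_kset_perm _ be).
apply: eq_bigr => e _; rewrite /pull /wperm; congr (w _ * _).
rewrite -[RHS]/((perm pI)^-1%g @: _).
have -> : label @: (be @: e) = perm pI @: (label @: (al @: e)).
  rewrite -!imset_comp; apply: eq_imset => t /=.
  by rewrite permE gK permM permK.
by rewrite -imset_permM mulgV -[LHS]imset_id; apply: eq_imset => t; rewrite perm1.
Qed.

Lemma inner_bounds w u pi : mininner k w u <= inner k (wperm w pi) u <= maxinner k w u.
Proof. by rewrite /mininner /maxinner bigmin_le le_bigmax. Qed.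

Lemma dens0 w : wtot k w = 0 -> dens k w = 0.
Proof. by rewrite /dens => ->; rewrite mul0r. Qed.

End Transport.

(** Pigeonhole: [k + 1] hypergraphs and [k] possible levels. Both orders of the pair are covered,
    since the theorem also asks for [i < j]. *)
Lemma disc_bound (R : realType) k : (1 <= k)%N -> exists2 c : R, 0 < c &
  forall n, (2 * k <= n)%N -> forall w : 'I_k.+1 -> hgraph R n,
    (forall i, wtot k (w i) = 0 /\ norm1 k (w i) = (binomial n k)%:R) ->
    exists i j : 'I_k.+1, i != j /\
      forall i' j', (i', j') = (i, j) \/ (i', j') = (j, i) ->
      [/\ 0 <= discp k (w i') (w j'), 0 <= discm k (w i') (w j') &
          c * n%:R ^+ k.+1 <= discp k (w i') (w j') * discm k (w i') (w j')].
Proof.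
move=> k1; set c1 : R := (2 * (1 + k%:R) ^+ k)^-1.
have c10 : 0 < c1 by rewrite invr_gt0 mulr_gt0 // exprn_gt0 // ltr_wpDr.
have [c c0 cP] := pair_bound k c10; exists c => // n kn w hw.
pose m := n./2; pose r : nat := odd n.
have nE : n = (m * 2 + r)%N by rewrite -[LHS]odd_double_half -muln2 addnC.
have r2 : (r < 2)%N by rewrite /r; case: (odd n).
have km : (1 <= k <= m)%N by rewrite k1 /m geq_half_double -mul2n.
clearbody m r.
pose T := ('I_m * bool + 'I_r)%type.
have tot i : \sum_(e : {set T} | #|e| == k) pull nE (w i) e = 0.
  exact: etrans (sum_pull k nE (w i)) (proj1 (hw i)).
(* The ordinal [d] stands for the level [d + 1]. *)
have lev i : exists d : 'I_k, forall A : {set 'I_m}, #|A| = d.+1 ->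
    c1 * #|rests r k A|%:R <= avg (fun al => `|Msum k (pull nE (w i)) A al|).
  have [|d dk dP] := @exists_level R m r k (pull nE (w i)) km (tot i).
    by rewrite -nE; exact: etrans (sum_pull k nE (fun e => `|w i e|)) (proj2 (hw i)).
  case: d dk dP => [|d] // dk dP; by exists (Ordinal dk).
have [f fP] := fin_all_exists lev.
have /injectivePn[i [j ij fij]] : ~~ injectiveb f.
  by apply/negP => /injectiveP /leq_card; rewrite !card_ord ltnn.
have key i' j' : f i' = f j' ->
    [/\ 0 <= discp k (w i') (w j'), 0 <= discm k (w i') (w j') &
        c * n%:R ^+ k.+1 <= discp k (w i') (w j') * discm k (w i') (w j')].
  move=> E; rewrite /discp /discm !dens0 ?(proj1 (hw _)) // !mul0r subr0 add0r.
  have fk : (1 <= (f i').+1 <= k)%N by rewrite ltn_ord.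
  have hab al be : mininner k (w i') (w j') <=
      inp k (pull nE (w i')) (pull nE (w j')) al be <= maxinner k (w i') (w j').
    have [pi ->] := inp_pull k nE (w i') (w j') al be; exact: inner_bounds.
  have hlev (A : {set 'I_m}) : #|A| = (f i').+1 ->
      c1 * #|rests r k A|%:R <= avg (fun al => `|Msum k (pull nE (w i')) A al|) /\
      c1 * #|rests r k A|%:R <= avg (fun al => `|Msum k (pull nE (w j')) A al|).
    by move=> Ad; split; apply: fP; rewrite -?E.
  have [/andP[a0 b0] h] := cP _ _ _ _ _ _ _ km r2 fk (tot i') hlev hab.
  by split; rewrite ?oppr_ge0 // [X in c * X%:R ^+ _]nE.
by exists i, j; split=> // i' j' [[-> ->]|[-> ->]]; apply: key.
Qed.

Theorem theorem1p2 (R : realType) (k : nat) : (1 <= k)%N ->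
  exists c c' : R, 0 < c /\ 0 < c' /\
  forall (n : nat), (2 * k <= n)%N ->
  forall w : 'I_k.+1 -> hgraph R n,
    (forall i, wtot k (w i) = 0 /\ norm1 k (w i) = (binomial n k)%:R) ->
    (exists i j : 'I_k.+1, i != j /\
       discp k (w i) (w j) * discm k (w i) (w j) >= c * (n%:R) ^+ k.+1)
    /\
    (exists i j : 'I_k.+1, (i < j)%N /\
       disc k (w i) (w j) >= c' * Num.sqrt ((n%:R) ^+ k.+1)).
Proof.
move=> k1; have [c c0 cP] := disc_bound R k1.
(* The square of the maximum of two nonnegative numbers is at least their product, hence
   [Num.sqrt c]. *)
exists c, (Num.sqrt c); rewrite sqrtr_gt0; do 2![split=> //] => n kn w hw.
have [i [j [ij hij]]] := cP n kn w hw.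
split; first by exists i, j; split=> //; have [] := hij i j (or_introl erefl).
have large i' j' : (i', j') = (i, j) \/ (i', j') = (j, i) ->
    Num.sqrt c * Num.sqrt (n%:R ^+ k.+1) <= disc k (w i') (w j').
  move/hij => [p0 m0 h]; rewrite -sqrtrM ?(ltW c0) // /disc.
  set p := discp _ _ _ in p0 h *; set q := discm _ _ _ in m0 h *.
  have M0 : 0 <= Num.max p q by rewrite le_max p0.
  rewrite -[leRHS]ger0_norm // -sqrtr_sqr ler_sqrt ?sqr_ge0 //.
  apply: le_trans h _; rewrite expr2.
  by apply: ler_pM; rewrite // le_max lexx ?orbT.
case: (ltngtP i j) => [lt|lt|/val_inj E]; last by rewrite E eqxx in ij.
  by exists i, j; split=> //; apply: large; left.
by exists j, i; split=> //; apply: large; right.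
Qed.
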